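(* Let $F=|\overline{y}|\sqrt{\phi(z,r)}$ be a Finsler metric defined on $M=\mathbb{R}\times\mathbb{B}^n(\rho)$, where $z=\frac{y^0}{|\overline{y}|}$ and $r=|\overline{x}|$. Set $$U=\frac{2\phi\phi_{zr}-\phi_z\phi_r}{2r(2\phi\phi_{zz}-\phi_z^2)},\qquad W=\frac{\phi_r}{2r(2\phi-z\phi_z)},$$ $$R=U-\frac{z}{n+2}\big(U_z+(n-1)W\big),\qquad T=\frac{1}{n+2}(3W-U_z).$$ Then $F$ has vanishing Douglas curvature if, and only if, $\phi$ satisfies $$R-zR_z=0,\qquad T_z=0,\qquad W_z-zW_{zz}=0.$$
   Context: Let $n\ge 2$, let $\mathbb{B}^n(\rho)\subset\mathbb{R}^n$ be the open ball of radius $\rho$ centred at the origin, and $M=\mathbb{R}\times\mathbb{B}^n(\rho)$ (so $\dim M=n+1$), with coordinates $x=(x^0,\overline{x})$, $\overline{x}=(x^1,\dots,x^n)$ and tangent coordinates $y=(y^0,\overline{y})$, $\overline{y}=(y^1,\dots,y^n)$; $|\cdot|$ is the Euclidean norm on $\mathbb{R}^n$. Capital indices run over $0,\dots,n$; subscripts $z,r$ denote partial derivatives. A Finsler metric on $M$ is a function $F:TM\to[0,\infty)$ that is $C^\infty$ on $TM\setminus\{0\}$ and restricts to a Minkowski norm on each tangent space. The metrics considered have the form $F=|\overline{y}|\sqrt{\phi(z,r)}$ with $\phi$ a differentiable function of $z$ and $r$; identities written in terms of $z$ and $r$ are read at points with $\overline{y}\neq0$, $\overline{x}\neq0$. With $g_{AB}=\frac12[F^2]_{y^Ay^B}$,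 the spray coefficients are $G^C=\frac14 g^{CA}\left([F^2]_{y^Ax^B}y^B-[F^2]_{x^A}\right)$ (sum over repeated indices). The Douglas curvature is $$D^A_{BCD}=\frac{\partial^3}{\partial y^B\partial y^C\partial y^D}\left(G^A-\frac{1}{n+2}\sum_{E=0}^n\frac{\partial G^E}{\partial y^E}\,y^A\right),$$ and $F$ has vanishing Douglas curvature if $D^A_{BCD}=0$ for all indices. *)

(* Defs.v *)
From HB Require Import structures.
From mathcomp Require Import all_boot all_order all_algebra.
From mathcomp Require Import all_classical all_reals all_analysis.

Set Implicit Arguments.
Unset Strict Implicit.
Unset Printing Implicit Defensive.

Import Order.TTheory GRing.Theory Num.Theory.
Import numFieldNormedType.Exports.

Local Open Scope classical_set_scope.
Local Open Scope ring_scope.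

(* [f] is infinitely differentiable at every point of the open set [U]: all
   its iterated directional derivatives (the empty iteration being [f] itself)
   are Frechet differentiable there. *)
Definition smooth_on (R : realType) (V : normedModType R) (U : set V)
    (f : V -> R) : Prop :=
  forall (s : seq V) (p : V), U p ->
    differentiable (foldr (fun v (g : V -> R) => 'D_v g) f s) p.

(* The norm [`| v |] that the library puts on row vectors is the sup norm. *)
Definition enorm (R : realType) (n : nat) (v : 'rV[R]_n) : R :=
  Num.sqrt (\sum_(i < n) v ord0 i ^+ 2).

(* A point of the tangent bundle of R^(n+1) is a pair (x, y) of rows indexed by
   0, ..., n; [time v] is v^0 and [space v] is (v^1, ..., v^n). *)
Definition tangent (R : realType) (n : nat) : normedModType R :=
  ('rV[R]_n.+1 * 'rV[R]_n.+1)%type.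

Definition time (R : realType) (n : nat) (v : 'rV[R]_n.+1) : R := v ord0 ord0.

Definition space (R : realType) (n : nat) (v : 'rV[R]_n.+1) : 'rV[R]_n :=
  \row_(i < n) v ord0 (lift ord0 i).

Definition dx (R : realType) (n : nat) (A : 'I_n.+1) (f : tangent R n -> R) :
    tangent R n -> R :=
  'D_((delta_mx ord0 A, 0) : tangent R n) f.

Definition dy (R : realType) (n : nat) (A : 'I_n.+1) (f : tangent R n -> R) :
    tangent R n -> R :=
  'D_((0, delta_mx ord0 A) : tangent R n) f.

Definition sqF (R : realType) (n : nat) (F : tangent R n -> R) :
    tangent R n -> R :=
  fun p => F p ^+ 2.

Definition fundamental (R : realType) (n : nat) (F : tangent R n -> R)
    (p : tangent R n) : 'M[R]_n.+1 :=
  \matrix_(A, B) (2^-1 * dy B (dy A (sqF F)) p).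

Definition slit_tangent (R : realType) (n : nat) (M : set 'rV[R]_n.+1) :
    set (tangent R n) :=
  [set p | M p.1 /\ p.2 != 0].

(* Only the values of [F] over [M] matter. The last three clauses say that
   [F] restricts to a Minkowski norm on each tangent space. *)
Definition is_finsler (R : realType) (n : nat) (M : set 'rV[R]_n.+1)
    (F : tangent R n -> R) : Prop :=
  [/\ forall x y, M x -> 0 <= F (x, y),
      smooth_on (slit_tangent M) F,
      forall x y, M x -> (F (x, y) = 0 <-> y = 0),
      forall x y (a : R), M x -> 0 < a -> F (x, a *: y) = a * F (x, y) &
      forall p, slit_tangent M p -> forall w : 'rV[R]_n.+1, w != 0 ->
        0 < \sum_A \sum_B fundamental F p A B * w ord0 A * w ord0 B].

Definition spray (R : realType) (n : nat) (F : tangent R n -> R)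
    (C : 'I_n.+1) (p : tangent R n) : R :=
  4^-1 * \sum_A invmx (fundamental F p) C A *
    (\sum_B dx B (dy A (sqF F)) p * p.2 ord0 B - dx A (sqF F) p).

Definition douglas (R : realType) (n : nat) (F : tangent R n -> R)
    (A B C D : 'I_n.+1) : tangent R n -> R :=
  dy D (dy C (dy B (fun p =>
    spray F A p - (n.+2%:R)^-1 * (\sum_E dy E (spray F E) p) * p.2 ord0 A))).

Definition vanishing_douglas (R : realType) (n : nat) (M : set 'rV[R]_n.+1)
    (F : tangent R n -> R) : Prop :=
  forall (A B C D : 'I_n.+1) (p : tangent R n),
    slit_tangent M p -> douglas F A B C D p = 0.

Definition cylinder (R : realType) (n : nat) (rho : R) : set 'rV[R]_n.+1 :=
  [set x | enorm (space x) < rho].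

(* The formula makes sense only where ybar <> 0; the values of [F] on the
   rest of the slit tangent bundle are then determined by continuity. *)
Definition has_cyl_form (R : realType) (n : nat) (rho : R)
    (F : tangent R n -> R) (phi : R -> R -> R) : Prop :=
  forall x y, cylinder rho x -> space y != 0 ->
    F (x, y) = enorm (space y) *
      Num.sqrt (phi (time y / enorm (space y)) (enorm (space x))).

(* Functions of (z, r) are curried, [z] first. *)
Definition dz (R : realType) (f : R -> R -> R) : R -> R -> R :=
  fun z r => derive1 (fun t => f t r) z.

Definition dr (R : realType) (f : R -> R -> R) : R -> R -> R :=
  fun z r => derive1 (fun t => f z t) r.

Definition cylU (R : realType) (phi : R -> R -> R) : R -> R -> R :=
  fun z r =>
    (2 * phi z r * dr (dz phi) z r - dz phi z r * dr phi z r) /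
    (2 * r * (2 * phi z r * dz (dz phi) z r - dz phi z r ^+ 2)).

Definition cylW (R : realType) (phi : R -> R -> R) : R -> R -> R :=
  fun z r => dr phi z r / (2 * r * (2 * phi z r - z * dz phi z r)).

Definition cylR (R : realType) (n : nat) (phi : R -> R -> R) : R -> R -> R :=
  fun z r => cylU phi z r -
    z / n.+2%:R * (dz (cylU phi) z r + (n%:R - 1) * cylW phi z r).

Definition cylT (R : realType) (n : nat) (phi : R -> R -> R) : R -> R -> R :=
  fun z r => (n.+2%:R)^-1 * (3 * cylW phi z r - dz (cylU phi) z r).

(* Main.v *)
Require Import Defs.
From HB Require Import structures.
From mathcomp Require Import all_boot all_order all_algebra.
From mathcomp Require Import all_classical all_reals all_analysis.
From mathcomp Require Import ring.

Set Implicit Arguments.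
Unset Strict Implicit.
Unset Printing Implicit Defensive.

Import Order.TTheory GRing.Theory Num.Theory.
Import numFieldNormedType.Exports.

Local Open Scope classical_set_scope.
Local Open Scope ring_scope.

(** Write s = |ybar|, t = xbar.ybar, so that F^2 = s^2 phi(z, r). The Douglas
    tensor only depends on the sprays up to a term P y^A with P of degree 1 in
    y: it consists of the third derivatives in y of the projective part
      Pi^A = G^A - (n+2)^-1 (sum_E dG^E/dy^E) y^A,
    which vanish exactly when Pi is a quadratic polynomial in y at every x.

    On the set of regular points (xbar <> 0, ybar <> 0) everything is explicit.
    Solving g G = b / 4 with the fundamental tensor of s^2 phi gives
      G^0 = s t (U + z V),   G^i = t (V + W) y^i - s^2 W x^i,
    with an auxiliary V ([cylV]) that only enters through t V y^A, a term P y^A.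
    Hence V drops out of the projective part ([proj_spray0], [proj_sprayi]):
      Pi^0 = s t R,   Pi^i = t T y^i - s^2 W x^i.
    The two denominators 2 phi - z phi_z and 2 phi phi_zz - phi_z^2 in U and W
    are positive since the fundamental tensor is positive definite; the first
    one needs a direction orthogonal to ybar, hence n >= 2 ([cyl_N_gt0],
    [cyl_hess_gt0]). The function phi is smooth because it is F^2 restricted to
    a two-dimensional affine slice ([smooth_phi]).

    If the Douglas curvature vanishes, third derivatives of Pi at points with
    xbar = r e_1 and ybar = e_2 give the three equations: differentiating three
    times along e_1 gives 3 r (R - z R_z) from Pi^0 and - 3 r z T_z from Pi^2,
    and differentiating once along y^0 and twice along e_1 gives
    - r (W_z - z W_zz) from Pi^1 ([forward_R], [forward_T], [forward_W]).

    Conversely the three equations integrate to R = a z, T = b and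
    W = c z^2 + d at fixed r ([euler_linear], [dz_eq0_cst],
    [euler_quadratic]). Since s z = y^0, the components of Pi become quadratic
    polynomials in y, so the Douglas curvature vanishes at regular points
    ([douglas_regular]). It is continuous on the whole slit tangent bundle, where
    the regular points are dense, so it vanishes everywhere
    ([smooth_douglas], [regular_dense]). *)

(* Another [space], for vector spaces, would hide the projection to R^n. *)
Local Notation space := Defs.space.

(** * Smooth functions on an open set *)

(** Differentiability is a property of the germ: the expansion of [f] to first
    order is also one of [g]. *)
Lemma near_eq_differentiable (R : realType) (V W : normedModType R)
    (f g : V -> W) (p : V) :
  (\near p, f p = g p) -> differentiable f p -> differentiable g p.
Proof.
move=> fg /diff_locallyP[cf ef].
have gp : f p = g p by exact: nbhs_singleton fg.
have eg : g \o shift p = cst (g p) + 'd f p +o_ 0 id.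
  apply/eqaddoP => e e0; move/eqaddoP: ef => /(_ _ e0).
  have fg0 : \forall h \near 0, f (h + p) = g (h + p).
    by move: fg; rewrite (near_shift 0) /=; apply: filterS => h; rewrite /= subr0.
  by apply: filterS2 fg0 => h /= fgh; rewrite !fctE /= -gp -fgh.
apply/diff_locallyP; have dg := diff_unique cf eg.
by rewrite dg.
Qed.

(** Smoothness up to order [k], peeling off the derivative applied first, whereas
    [smooth_on] peels off the one applied last. Here the closure properties go by
    induction on [k]: the derivative of a product or an inverse is a combination
    of products to which the lower order applies. *)
Fixpoint Ck (R : realType) (V : normedModType R) (U : set V) (k : nat)
    (f : V -> R) : Prop :=
  (forall p, U p -> differentiable f p) /\
  (if k is k'.+1 then forall v, Ck U k' ('D_v f) else True).

Lemma smooth_onP (R : realType) (V : normedModType R) (U : set V)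
    (f : V -> R) : smooth_on U f <-> forall k, Ck U k f.
Proof.
split=> [sf k|].
  elim: k f sf => [|k IH] f sf; split=> //; try exact: (sf [::]).
  move=> v.
  apply: IH => s p Up; have := sf (rcons s v) p Up.
  by rewrite foldr_rcons.
move=> Cf s; elim/last_ind: s f Cf => [|s v IH] f Cf p Up /=.
  by have [/(_ _ Up)] := Cf 0%N.
by rewrite foldr_rcons; apply: IH => // k; have [_] := Cf k.+1; exact.
Qed.

Lemma Ck_diff (R : realType) (V : normedModType R) (U : set V) k (f : V -> R) p :
  Ck U k f -> U p -> differentiable f p.
Proof. by case: k => [|k] [] df _; apply: df. Qed.

Lemma CkW (R : realType) (V : normedModType R) (U : set V) k (f : V -> R) :
  Ck U k.+1 f -> Ck U k f.
Proof.
elim: k f => [|k IH] f [df Df]; split=> // v.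
exact: IH (Df v).
Qed.

Lemma derive_eq_on (R : realType) (V W : normedModType R) (U : set V)
    (f g : V -> W) (v : V) : open U -> (forall p, U p -> f p = g p) ->
  forall p, U p -> 'D_v f p = 'D_v g p.
Proof.
move=> oU fg p Up; apply: near_eq_derive.
by apply: filterS (open_nbhs_nbhs (conj oU Up)).
Qed.

Lemma Ck_eq (R : realType) (V : normedModType R) (U : set V) k (f g : V -> R) :
  open U -> (forall p, U p -> f p = g p) -> Ck U k f -> Ck U k g.
Proof.
move=> oU; elim: k f g => [|k IH] f g fg [df Df]; split=> //; [|move=> p Up|move=> v].
- move=> p Up; apply: near_eq_differentiable (df p Up).
  by apply: filterS (open_nbhs_nbhs (conj oU Up)).
- apply: near_eq_differentiable (df p Up).
  by apply: filterS (open_nbhs_nbhs (conj oU Up)).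
- exact: IH _ _ (derive_eq_on v oU fg) (Df v).
Qed.

Lemma CkD (R : realType) (V : normedModType R) (U : set V) k (f g : V -> R) :
  open U -> Ck U k f -> Ck U k g -> Ck U k (f + g).
Proof.
move=> oU; elim: k f g => [|k IH] f g [df Df] [dg Dg]; split=> //; [|move=> p Up|move=> v].
- by move=> p Up; apply: differentiableD; auto.
- by apply: differentiableD; auto.
- apply: Ck_eq (IH _ _ (Df v) (Dg v)) => // p Up.
  by rewrite deriveD//; apply: diff_derivable; auto.
Qed.

Lemma Ck_cst (R : realType) (V : normedModType R) (U : set V) k (c : R) :
  Ck U k (cst c).
Proof.
elim: k c => [|k IH] c; split=> // v.
suff -> : 'D_v (cst c) = (cst 0 : V -> R) by [].
by apply/funext => p; rewrite derive_cst.
Qed.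

Lemma CkM (R : realType) (V : normedModType R) (U : set V) k (f g : V -> R) :
  open U -> Ck U k f -> Ck U k g -> Ck U k (f * g).
Proof.
move=> oU; elim: k f g => [|k IH] f g Cf Cg.
  by split=> // p Up; apply: differentiableM; [exact: Ck_diff Cf Up|exact: Ck_diff Cg Up].
split=> [p Up|v].
  by apply: differentiableM; [exact: Ck_diff Cf Up|exact: Ck_diff Cg Up].
have [df Df] := Cf; have [dg Dg] := Cg.
have := CkD oU (IH _ _ (CkW Cf) (Dg v)) (IH _ _ (CkW Cg) (Df v)).
apply: Ck_eq => // p Up.
by rewrite deriveM//; apply: diff_derivable; auto.
Qed.

Lemma CkV (R : realType) (V : normedModType R) (U : set V) k (f : V -> R) :
  open U -> (forall p, U p -> f p != 0) -> Ck U k f ->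
  Ck U k (fun p => (f p)^-1).
Proof.
move=> oU f0; elim: k f f0 => [|k IH] f f0 Cf.
  by split=> // p Up; apply: differentiableV; [exact: Ck_diff Cf Up|exact: f0].
split=> [p Up|v].
  by apply: differentiableV; [exact: Ck_diff Cf Up|exact: f0].
have [df Df] := Cf; have CV := IH _ f0 (CkW Cf).
have := CkM oU (CkM oU CV CV) (CkM oU (Ck_cst U k (-1)) (Df v)).
apply: Ck_eq => // p Up.
rewrite deriveV ?f0//; last by apply: diff_derivable; auto.
rewrite !fctE /GRing.scale /= expr2 invfM.
by rewrite mulN1r mulNr mulrN.
Qed.

Lemma smooth_eq (R : realType) (V : normedModType R) (U : set V) (f g : V -> R) :
  open U -> (forall p, U p -> f p = g p) -> smooth_on U f -> smooth_on U g.
Proof. by move=> oU fg /smooth_onP Cf; apply/smooth_onP => k; exact: Ck_eq (Cf k). Qed.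

Lemma smooth_cst (R : realType) (V : normedModType R) (U : set V) (c : R) :
  smooth_on U (fun=> c).
Proof. by apply/smooth_onP => k; exact: Ck_cst. Qed.

Lemma smoothD (R : realType) (V : normedModType R) (U : set V) (f g : V -> R) :
  open U -> smooth_on U f -> smooth_on U g -> smooth_on U (fun p => f p + g p).
Proof.
by move=> oU /smooth_onP Cf /smooth_onP Cg; apply/smooth_onP => k; exact: CkD.
Qed.

Lemma smoothM (R : realType) (V : normedModType R) (U : set V) (f g : V -> R) :
  open U -> smooth_on U f -> smooth_on U g -> smooth_on U (fun p => f p * g p).
Proof.
by move=> oU /smooth_onP Cf /smooth_onP Cg; apply/smooth_onP => k; exact: CkM.
Qed.

Lemma smoothV (R : realType) (V : normedModType R) (U : set V) (f : V -> R) :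
  open U -> (forall p, U p -> f p != 0) -> smooth_on U f ->
  smooth_on U (fun p => (f p)^-1).
Proof.
by move=> oU f0 /smooth_onP Cf; apply/smooth_onP => k; exact: CkV.
Qed.

Lemma smoothN (R : realType) (V : normedModType R) (U : set V) (f : V -> R) :
  open U -> smooth_on U f -> smooth_on U (fun p => - f p).
Proof.
move=> oU sf; have := smoothM oU (@smooth_cst _ _ U (-1)) sf.
by apply: smooth_eq => // p _; rewrite mulN1r.
Qed.

Lemma smoothB (R : realType) (V : normedModType R) (U : set V) (f g : V -> R) :
  open U -> smooth_on U f -> smooth_on U g -> smooth_on U (fun p => f p - g p).
Proof. by move=> oU sf sg; apply: smoothD => //; exact: smoothN. Qed.

Lemma smoothX (R : realType) (V : normedModType R) (U : set V) (f : V -> R) k :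
  open U -> smooth_on U f -> smooth_on U (fun p => f p ^+ k).
Proof.
move=> oU sf; elim: k => [|k IH].
  by apply: smooth_eq (@smooth_cst _ _ U 1) => // p _; rewrite expr0.
by have := smoothM oU sf IH; apply: smooth_eq => // p _; rewrite exprS.
Qed.

Lemma smooth_sum (R : realType) (V : normedModType R) (U : set V) (I : Type)
    (r : seq I) (f : I -> V -> R) :
  open U -> (forall i, smooth_on U (f i)) -> smooth_on U (fun p => \sum_(i <- r) f i p).
Proof.
move=> oU sf; elim: r => [|i r IH].
  by apply: smooth_eq (@smooth_cst _ _ U 0) => // p _; rewrite big_nil.
by have := smoothD oU (sf i) IH; apply: smooth_eq => // p _; rewrite big_cons.
Qed.

Lemma smooth_prod (R : realType) (V : normedModType R) (U : set V) (I : Type)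
    (r : seq I) (f : I -> V -> R) :
  open U -> (forall i, smooth_on U (f i)) -> smooth_on U (fun p => \prod_(i <- r) f i p).
Proof.
move=> oU sf; elim: r => [|i r IH].
  by apply: smooth_eq (@smooth_cst _ _ U 1) => // p _; rewrite big_nil.
by have := smoothM oU (sf i) IH; apply: smooth_eq => // p _; rewrite big_cons.
Qed.

Lemma smooth_det (R : realType) (V : normedModType R) (U : set V) (n : nat)
    (M : V -> 'M[R]_n) :
  open U -> (forall i j, smooth_on U (fun p => M p i j)) ->
  smooth_on U (fun p => \det (M p)).
Proof.
move=> oU sM; apply: smooth_sum => // s; apply: smoothM => //.
  exact: smooth_cst.
exact: smooth_prod.
Qed.

(** The inverse is the adjugate divided by the determinant, both polynomial in the
    entries. *)
Lemma smooth_invmx (R : realType) (V : normedModType R) (U : set V) (n : nat)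
    (M : V -> 'M[R]_n) :
  open U -> (forall p, U p -> M p \in unitmx) ->
  (forall i j, smooth_on U (fun p => M p i j)) ->
  forall i j, smooth_on U (fun p => invmx (M p) i j).
Proof.
move=> oU uM sM i j.
apply: (@smooth_eq _ _ _ (fun p => (\det (M p))^-1 *
    ((-1) ^+ (j + i) * \det (row' j (col' i (M p)))))) => //.
  by move=> p Up; rewrite /invmx uM// !mxE.
apply: smoothM => //.
  apply: smoothV => //; last exact: smooth_det.
  by move=> p /uM; rewrite unitmxE unitfE.
apply: smoothM => //; first exact: smooth_cst.
apply: smooth_det => // k l.
by apply: smooth_eq (sM (lift j k) (lift i l)) => // p _; rewrite !mxE.
Qed.

Lemma smooth_derive (R : realType) (V : normedModType R) (U : set V) (f : V -> R) v :
  smooth_on U f -> smooth_on U ('D_v f).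
Proof. by move=> sf s p Up; have := sf (rcons s v) p Up; rewrite foldr_rcons. Qed.

Lemma smooth_differentiable (R : realType) (V : normedModType R) (U : set V)
    (f : V -> R) p : smooth_on U f -> U p -> differentiable f p.
Proof. by move=> /(_ [::]); exact. Qed.

Lemma smooth_sub (R : realType) (V : normedModType R) (U U' : set V)
    (f : V -> R) : U `<=` U' -> smooth_on U' f -> smooth_on U f.
Proof. by move=> UU' sf s p /UU'; exact: sf. Qed.

(** Iterated derivatives of [f \o a] are those of [f] along the images under the
    linear part [l], composed with [a]. *)
Lemma smooth_affine (R : realType) (V W : normedModType R) (U : set W)
    (f : W -> R) (a l : V -> W) :
  (forall (h : R) p v, a (h *: v + p) = h *: l v + a p) ->
  (forall p, differentiable a p) ->
  smooth_on U f -> smooth_on (a @^-1` U) (f \o a).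
Proof.
move=> al da sf s p Up.
have -> : foldr (fun v (g : V -> R) => 'D_v g) (f \o a) s =
    foldr (fun v (g : W -> R) => 'D_v g) f (map l s) \o a.
  elim: s => //= v s ->; apply/funext => q /=.
  rewrite /derive.
  set F1 := (fun h : R => _) ; set F2 := (fun h : R => _).
  by have -> : F1 = F2 by apply/funext => h; rewrite /F1 /F2 /= al.
by apply: differentiable_comp; [exact: da|exact: sf].
Qed.

Lemma is_derive_lin (R : realType) (V : normedModType R) (f : V -> R) p v :
  (forall (h : R) p v, f (h *: v + p) = h * f v + f p) ->
  is_derive p v f (f v).
Proof.
move=> fl.
have cv : h^-1 *: ((f \o shift p) (h *: v) - f p) @[h --> 0^'] --> f v.
  apply: cvg_near_cst; near=> h => /=.
  rewrite fl addrK /GRing.scale/= mulrA mulVf ?mul1r//.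
  by near: h; exact: nbhs_dnbhs_neq.
by apply: DeriveDef; [apply/cvg_ex; exists (f v)|apply: cvg_lim].
Unshelve. all: by end_near. Qed.

Lemma smooth_lin (R : realType) (V : normedModType R) (U : set V)
    (f : V -> R) :
  open U -> (forall (h : R) p v, f (h *: v + p) = h * f v + f p) ->
  (forall p, differentiable f p) -> smooth_on U f.
Proof.
move=> oU fl df; apply/smooth_onP => -[|k]; split=> // v.
suff -> : 'D_v f = cst (f v) by exact: Ck_cst.
by apply/funext => p; have [_ ->] := is_derive_lin p v fl.
Qed.

(** * Directional derivatives *)

(** Directional derivatives only see the restriction of [f] to a line, which
    transfers the one-variable rules to any normed module. *)
Lemma is_derive_line (R : realType) (V W : normedModType R) (f : V -> W)
    (p v : V) (df : W) :
  is_derive p v f df <-> is_derive (0 : R) 1 (fun h : R => f (h *: v + p)) df.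
Proof.
have e : 'D_1 (fun h : R => f (h *: v + p)) 0 = 'D_v f p.
  rewrite /derive.
  set F1 := (fun h : R => h^-1 *: _); set F2 := (fun h : R => h^-1 *: _).
  suff -> : F1 = F2 by [].
  by apply/funext => h; rewrite /F1 /F2 /= addr0 scale0r add0r [h%:A]mulr1.
split=> -[df1 df2]; apply: DeriveDef.
- exact: (derivable1P f p v).1.
- by rewrite e.
- exact: (derivable1P f p v).2.
- by rewrite -e.
Qed.

Lemma is_derive_eq_line (R : realType) (V W : normedModType R) (f g : V -> W)
    (p v : V) (df : W) :
  (forall h : R, f (h *: v + p) = g (h *: v + p)) ->
  is_derive p v f df -> is_derive p v g df.
Proof.
by move=> fg /is_derive_line ?; apply/is_derive_line; under eq_fun do rewrite -fg.
Qed.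

Section rules.
Variables (R : realType) (V : normedModType R).
Implicit Types (f g : V -> R) (p v : V).

Lemma dir_cst p v (c : R) : is_derive p v (fun=> c) 0.
Proof. exact: is_derive_cst. Qed.

Lemma dirD f g p v df dg : is_derive p v f df -> is_derive p v g dg ->
  is_derive p v (fun q => f q + g q) (df + dg).
Proof. exact: is_deriveD. Qed.

Lemma dirN f p v df : is_derive p v f df ->
  is_derive p v (fun q => - f q) (- df).
Proof. exact: is_deriveN. Qed.

Lemma dirM f g p v df dg : is_derive p v f df -> is_derive p v g dg ->
  is_derive p v (fun q => f q * g q) (df * g p + f p * dg).
Proof.
move=> Hf Hg; apply: is_derive_eq (is_deriveM Hf Hg) _.
by rewrite /GRing.scale/= addrC mulrC.
Qed.

Lemma dirV f p v df : f p != 0 -> is_derive p v f df ->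
  is_derive p v (fun q => (f q)^-1) (- df / f p ^+ 2).
Proof.
move=> f0 [Hf <-]; apply: DeriveDef; first exact: derivableV.
by rewrite deriveV// /GRing.scale/= mulNr mulNr mulrC.
Qed.

Lemma dirX f p v df n : is_derive p v f df ->
  is_derive p v (fun q => f q ^+ n.+1) (n.+1%:R * f p ^+ n * df).
Proof.
by move=> Hf; rewrite -exprfctE; apply: is_derive_eq (is_deriveX _ Hf) _.
Qed.

Lemma dir_sum (I : Type) (s : seq I) (f : I -> V -> R) (df : I -> R) p v :
  (forall i, is_derive p v (f i) (df i)) ->
  is_derive p v (fun q => \sum_(i <- s) f i q) (\sum_(i <- s) df i).
Proof.
move=> H; elim: s => [|i s IH].
  by under eq_fun do rewrite big_nil; rewrite big_nil; exact: dir_cst.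
by under eq_fun do rewrite big_cons; rewrite big_cons; exact: dirD.
Qed.

Lemma dir_comp (h : R -> R) f p v df dh :
  is_derive p v f df -> is_derive (f p) 1 h dh ->
  is_derive p v (fun q => h (f q)) (dh * df).
Proof.
move=> /is_derive_line Hf Hh; apply/is_derive_line.
by apply: is_derive1_comp; rewrite /= scale0r add0r.
Qed.

Lemma dir_sqrt f p v df : 0 < f p -> is_derive p v f df ->
  is_derive p v (fun q => Num.sqrt (f q)) (df / (2 * Num.sqrt (f p))).
Proof.
move=> f0 Hf; rewrite mulrC; apply: dir_comp => //.
exact: is_derive1_sqrt.
Qed.

End rules.

Lemma dzE (R : realType) (H : R -> R -> R) z r :
  dz H z r = 'D_((1, 0) : R * R) (fun q : R * R => H q.1 q.2) (z, r).
Proof.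
rewrite /dz derive1E /derive.
set F1 := (fun h : R => h^-1 *: _); set F2 := (fun h : R => h^-1 *: _).
suff -> : F1 = F2 by [].
by apply/funext => h; rewrite /F1 /F2 /= [h *: 0]mulr0 add0r.
Qed.

Lemma drE (R : realType) (H : R -> R -> R) z r :
  dr H z r = 'D_((0, 1) : R * R) (fun q : R * R => H q.1 q.2) (z, r).
Proof.
rewrite /dr derive1E /derive.
set F1 := (fun h : R => h^-1 *: _); set F2 := (fun h : R => h^-1 *: _).
suff -> : F1 = F2 by [].
by apply/funext => h; rewrite /F1 /F2 /= [h *: 0]mulr0 add0r.
Qed.

(** Along a line, (a, b) is a curve in the plane; differentiability of [H] in both
    variables gives the chain rule for it. *)
Lemma dir_chain (R : realType) (V : normedModType R) (H : R -> R -> R)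
    (a b : V -> R) p v da db :
  differentiable (fun q : R * R => H q.1 q.2) ((a p, b p) : R * R) ->
  is_derive p v a da -> is_derive p v b db ->
  is_derive p v (fun q => H (a q) (b q))
    (dz H (a p) (b p) * da + dr H (a p) (b p) * db).
Proof.
move=> dH /is_derive_line Ha /is_derive_line Hb; apply/is_derive_line.
pose c (h : R) : R * R := (a (h *: v + p), b (h *: v + p)).
have [/derivable1_diffP Da Ea] := Ha; have [/derivable1_diffP Db Eb] := Hb.
have Dc : differentiable c (0 : R) by exact: differentiable_pair.
have c0 : c 0 = (a p, b p) by rewrite /c scale0r add0r.
have dHc : differentiable (fun q : R * R => H q.1 q.2) (c 0) by rewrite c0.
have := differentiable_comp Dc dHc => DHc.
apply: DeriveDef; first exact/derivable1_diffP.
rewrite deriveE// [X in 'd X _](_ : _ = (fun q : R * R => H q.1 q.2) \o c)//.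
rewrite diff_comp//= diff_pair//= -!deriveE//.
rewrite Ea Eb c0 dzE drE [in RHS]deriveE// [in RHS]deriveE//.
have -> : ((da, db) : R * R) = da *: ((1, 0) : R * R) + db *: ((0, 1) : R * R).
  by congr pair; rewrite /= ?[_ *: 1]mulr1 ?[_ *: 0]mulr0 ?addr0 ?add0r.
rewrite deriveE// linearD !linearZ.
by rewrite /GRing.scale/= mulrC [X in _ + X]mulrC.
Qed.

(** * The coordinates z, r, |ybar| and xbar.ybar *)

Definition dot (R : realType) (n : nat) (a b : 'rV[R]_n) : R :=
  \sum_(i < n) a ord0 i * b ord0 i.

Section dot.
Variables (R : realType) (n : nat).
Implicit Types a b c : 'rV[R]_n.

Lemma dotC a b : dot a b = dot b a.
Proof. by apply: eq_bigr => i _; rewrite mulrC. Qed.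

Lemma dot0r a : dot a 0 = 0.
Proof. by apply: big1 => i _; rewrite mxE mulr0. Qed.

Lemma dot0l a : dot 0 a = 0.
Proof. by rewrite dotC dot0r. Qed.

Lemma dot_deltar a i : dot a (delta_mx ord0 i) = a ord0 i.
Proof.
rewrite /dot (bigD1 i)//= mxE !eqxx mulr1 big1 ?addr0// => j /negPf ji.
by rewrite mxE eqxx ji mulr0.
Qed.

Lemma dot_deltal a i : dot (delta_mx ord0 i) a = a ord0 i.
Proof. by rewrite dotC dot_deltar. Qed.

Lemma dotZr a (h : R) b : dot a (h *: b) = h * dot a b.
Proof. by rewrite /dot mulr_sumr; apply: eq_bigr => i _; rewrite mxE mulrCA. Qed.

Lemma dotZl (h : R) a b : dot (h *: a) b = h * dot a b.
Proof. by rewrite dotC dotZr dotC. Qed.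

Lemma enormE a : enorm a = Num.sqrt (dot a a).
Proof. by rewrite /enorm; congr Num.sqrt; apply: eq_bigr => i _; rewrite expr2. Qed.

Lemma dot_ge0 a : 0 <= dot a a.
Proof. by apply: sumr_ge0 => i _; rewrite -expr2 sqr_ge0. Qed.

Lemma enorm_sqr a : enorm a ^+ 2 = dot a a.
Proof. by rewrite enormE sqr_sqrtr// dot_ge0. Qed.

Lemma enorm_ge0 a : 0 <= enorm a.
Proof. exact: sqrtr_ge0. Qed.

Lemma enorm_gt0 a : (0 < enorm a) = (a != 0).
Proof.
rewrite enormE sqrtr_gt0 lt_def dot_ge0 andbT; congr (~~ _).
apply/eqP/eqP => [a0|->]; last by rewrite dot0r.
have {}a0 : \sum_(i < n) (a ord0 i) ^+ 2 = 0.
  by rewrite -[RHS]a0; apply: eq_bigr => i _; rewrite expr2.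
apply/rowP => i; rewrite mxE; apply/eqP; rewrite -sqrf_eq0.
by move/eqP: a0; rewrite psumr_eq0 => [/allP/(_ i)|j _]; rewrite ?mem_index_enum ?sqr_ge0//; apply.
Qed.

Lemma enormZ_delta (h : R) i : 0 <= h -> enorm (h *: delta_mx ord0 i : 'rV[R]_n) = h.
Proof.
move=> h0; rewrite enormE dotZr dotZl dot_deltar mxE !eqxx mulr1 -expr2.
by rewrite sqrtr_sqr ger0_norm.
Qed.

End dot.

Section coordinates.
Variables (R : realType) (n : nat).
Implicit Types (p v : tangent R n).

Definition ynorm p : R := enorm (space p.2).
Definition slope p : R := time p.2 / ynorm p.
Definition xnorm p : R := enorm (space p.1).
Definition xydot p : R := dot (space p.1) (space p.2).

Lemma dir_ycoord B p v : is_derive p v (fun q : tangent R n => q.2 ord0 B) (v.2 ord0 B).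
Proof.
by apply: (is_derive_lin (f := fun q : tangent R n => q.2 ord0 B)) => h q w; rewrite !mxE.
Qed.

Lemma dir_time p v : is_derive p v (fun q : tangent R n => time q.2) (time v.2).
Proof. exact: dir_ycoord. Qed.

Lemma dir_y i p v :
  is_derive p v (fun q : tangent R n => space q.2 ord0 i) (space v.2 ord0 i).
Proof.
apply: (is_derive_lin (f := fun q : tangent R n => space q.2 ord0 i)) => h q w.
by rewrite !mxE.
Qed.

Lemma dir_x i p v :
  is_derive p v (fun q : tangent R n => space q.1 ord0 i) (space v.1 ord0 i).
Proof.
apply: (is_derive_lin (f := fun q : tangent R n => space q.1 ord0 i)) => h q w.
by rewrite !mxE.
Qed.

Lemma dir_xydot p v : is_derive p v xydot
  (dot (space v.1) (space p.2) + dot (space p.1) (space v.2)).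
Proof.
rewrite /dot -big_split /=; apply: dir_sum => i.
by apply: dirM; [exact: dir_x|exact: dir_y].
Qed.

Lemma dir_ynorm p v : space p.2 != 0 ->
  is_derive p v ynorm (dot (space p.2) (space v.2) / ynorm p).
Proof.
move=> p0; rewrite /ynorm [X in is_derive _ _ X _](_ : _ =
  fun q : tangent R n => Num.sqrt (dot (space q.2) (space q.2))); last first.
  by apply/funext => q; rewrite enormE.
apply: is_derive_eq.
  apply: dir_sqrt; first by rewrite -sqrtr_gt0 -enormE enorm_gt0.
  by apply: dir_sum => i; apply: dirM; exact: dir_y.
rewrite big_split /= -/(dot _ _) -/(dot _ _) -enormE dotC.
have : enorm (space p.2) != 0 by rewrite gt_eqF// enorm_gt0.
by move=> ?; field.
Qed.

Lemma dir_xnorm p v : space p.1 != 0 ->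
  is_derive p v xnorm (dot (space p.1) (space v.1) / xnorm p).
Proof.
move=> p0; rewrite /xnorm [X in is_derive _ _ X _](_ : _ =
  fun q : tangent R n => Num.sqrt (dot (space q.1) (space q.1))); last first.
  by apply/funext => q; rewrite enormE.
apply: is_derive_eq.
  apply: dir_sqrt; first by rewrite -sqrtr_gt0 -enormE enorm_gt0.
  by apply: dir_sum => i; apply: dirM; exact: dir_x.
rewrite big_split /= -/(dot _ _) -/(dot _ _) -enormE dotC.
have : enorm (space p.1) != 0 by rewrite gt_eqF// enorm_gt0.
by move=> ?; field.
Qed.

Lemma ynorm_neq0 p : space p.2 != 0 -> ynorm p != 0.
Proof. by move=> ?; rewrite gt_eqF// enorm_gt0. Qed.

Lemma dir_slope p v : space p.2 != 0 ->
  is_derive p v slope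
    (time v.2 / ynorm p - slope p * dot (space p.2) (space v.2) / ynorm p ^+ 2).
Proof.
move=> p0; have s0 := ynorm_neq0 p0; apply: is_derive_eq.
  by apply: dirM; [exact: dir_time|apply: dirV => //; exact: dir_ynorm].
by rewrite /slope; field.
Qed.

Lemma time_delta0 : time (delta_mx ord0 ord0 : 'rV[R]_n.+1) = 1.
Proof. by rewrite /time mxE !eqxx. Qed.
Lemma time_delta i : time (delta_mx ord0 (lift ord0 i) : 'rV[R]_n.+1) = 0.
Proof. by rewrite /time mxE. Qed.
Lemma space_delta0 : space (delta_mx ord0 ord0 : 'rV[R]_n.+1) = 0.
Proof. by apply/rowP => i; rewrite !mxE. Qed.
Lemma space_delta i :
  space (delta_mx ord0 (lift ord0 i) : 'rV[R]_n.+1) = delta_mx ord0 i.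
Proof.
by apply/rowP => j; rewrite !mxE !eqxx /= (inj_eq (lift_inj (h := ord0))).
Qed.
Lemma time0 : time (0 : 'rV[R]_n.+1) = 0. Proof. by rewrite /time mxE. Qed.
Lemma space0 : space (0 : 'rV[R]_n.+1) = 0.
Proof. by apply/rowP => i; rewrite !mxE. Qed.

Lemma time_lin (h : R) (a b : 'rV[R]_n.+1) : time (h *: a + b) = h * time a + time b.
Proof. by rewrite /time !mxE. Qed.
Lemma space_lin (h : R) (a b : 'rV[R]_n.+1) : space (h *: a + b) = h *: space a + space b.
Proof. by apply/rowP => i; rewrite !mxE. Qed.

Lemma xydot_sum p : \sum_i space p.2 ord0 i * space p.1 ord0 i = xydot p.
Proof. by rewrite /xydot dotC. Qed.
Lemma ynorm_sum p : \sum_i space p.2 ord0 i * space p.2 ord0 i = ynorm p ^+ 2.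
Proof. by rewrite /ynorm enorm_sqr. Qed.

End coordinates.

(** * Smoothness of phi *)

Lemma lin_differentiable (R : realType) (V W : normedModType R) (f : V -> W) p :
  (forall (h : R) u v, f (h *: u + v) = h *: f u + f v) -> continuous f ->
  differentiable f p.
Proof.
move=> fl cf.
pose fM := GRing.isLinear.Build _ _ _ _ f fl.
pose fL : {linear V -> W} := HB.pack f fM.
exact: (@linear_differentiable _ _ _ fL).
Qed.

Lemma differentiable_fst (R : realType) (V W : normedModType R) (p : V * W) :
  differentiable (fst : V * W -> V) p.
Proof. by apply: lin_differentiable => // q; exact: cvg_fst. Qed.

Lemma differentiable_snd (R : realType) (V W : normedModType R) (p : V * W) :
  differentiable (snd : V * W -> W) p.
Proof. by apply: lin_differentiable => // q; exact: cvg_snd. Qed.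

Lemma differentiable_ycoord (R : realType) (n : nat) A (p : tangent R n) :
  differentiable (fun q : tangent R n => q.2 ord0 A) p.
Proof.
exact: (differentiable_comp (differentiable_snd p) (differentiable_coord _ _ _)).
Qed.

Lemma differentiable_xcoord (R : realType) (n : nat) A (p : tangent R n) :
  differentiable (fun q : tangent R n => q.1 ord0 A) p.
Proof.
exact: (differentiable_comp (differentiable_fst p) (differentiable_coord _ _ _)).
Qed.

Lemma smooth_ycoord (R : realType) (n : nat) (U : set (tangent R n)) A :
  open U -> smooth_on U (fun q : tangent R n => q.2 ord0 A).
Proof.
move=> oU; apply: smooth_lin => // [h p v|p]; last exact: differentiable_ycoord.
by rewrite !mxE.
Qed.

Lemma open_gt0 (R : realType) (V : normedModType R) (f : V -> R) :
  (forall p, differentiable f p) -> open [set p | 0 < f p].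
Proof.
move=> df; apply: (@open_comp _ _ f [set x | 0 < x]); last exact: open_gt.
by move=> p _; exact: differentiable_continuous.
Qed.

Section domains.
Variables (R : realType) (n : nat) (rho : R).

Definition strip : set (R * R) := [set q | 0 < q.2 < rho].

(** The points where the formulas in z and r make sense. *)
Definition regular : set (tangent R n) :=
  [set p | 0 < xnorm p < rho /\ space p.2 != 0].

Lemma open_strip : open strip.
Proof.
rewrite (_ : strip = [set q : R * R | 0 < q.2] `&` [set q | 0 < rho - q.2]).
  apply: openI; apply: open_gt0 => q; first exact: differentiable_snd.
  by apply: differentiableB => //; exact: differentiable_snd.
apply/seteqP; split=> q /=; rewrite /strip/= subr_gt0; first by move/andP.
by move=> [-> ->].
Qed.

Let dx2 (p : tangent R n) :
  differentiable (fun q : tangent R n => dot (space q.1) (space q.1)) p.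
Proof.
have -> : (fun q : tangent R n => dot (space q.1) (space q.1)) =
    \sum_(i < n) (fun q : tangent R n => q.1 ord0 (lift ord0 i) ^+ 2).
  apply/funext => q; rewrite fct_sumE; apply: eq_bigr => i _.
  by rewrite mxE expr2.
apply: differentiable_sum => i.
by rewrite -exprfctE; apply: differentiableX; exact: differentiable_xcoord.
Qed.

Let dy2 (p : tangent R n) :
  differentiable (fun q : tangent R n => dot (space q.2) (space q.2)) p.
Proof.
have -> : (fun q : tangent R n => dot (space q.2) (space q.2)) =
    \sum_(i < n) (fun q : tangent R n => q.2 ord0 (lift ord0 i) ^+ 2).
  apply/funext => q; rewrite fct_sumE; apply: eq_bigr => i _.
  by rewrite mxE expr2.
apply: differentiable_sum => i.
by rewrite -exprfctE; apply: differentiableX; exact: differentiable_ycoord.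
Qed.

Lemma dot_gt0 m (a : 'rV[R]_m) : (0 < dot a a) = (a != 0).
Proof. by rewrite -enorm_gt0 enormE sqrtr_gt0. Qed.

Hypothesis rho0 : 0 < rho.

Lemma enorm_lt m (a : 'rV[R]_m) : (enorm a < rho) = (0 < rho ^+ 2 - dot a a).
Proof. by rewrite subr_gt0 -enorm_sqr ltr_pXn2r// ?nnegrE ?enorm_ge0// ltW. Qed.

Lemma open_regular : open regular.
Proof.
rewrite (_ : regular =
  [set p | 0 < dot (space p.1) (space p.1)] `&`
  [set p | 0 < rho ^+ 2 - dot (space p.1) (space p.1)] `&`
  [set p | 0 < dot (space p.2) (space p.2)]).
  by apply: openI; [apply: openI|]; apply: open_gt0 => // q; apply: differentiableB.
apply/seteqP; split=> p /=;
  rewrite /regular /= /xnorm !dot_gt0 -enorm_lt enorm_gt0.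
  by move=> [/andP[-> ->] ->].
by move=> [[-> ->] ->].
Qed.

Lemma open_slit : open (slit_tangent (cylinder rho : set 'rV[R]_n.+1)).
Proof.
rewrite (_ : slit_tangent _ =
  [set p | 0 < rho ^+ 2 - dot (space p.1) (space p.1)] `&`
  [set p : tangent R n | 0 < dot p.2 p.2]).
  apply: openI; apply: open_gt0 => q; first exact: differentiableB.
  have -> : (fun q : tangent R n => dot q.2 q.2) =
      \sum_(i < n.+1) (fun q : tangent R n => q.2 ord0 i ^+ 2).
    apply/funext => p; rewrite fct_sumE; apply: eq_bigr => i _.
    by rewrite expr2.
  apply: differentiable_sum => i.
  by rewrite -exprfctE; apply: differentiableX; exact: differentiable_ycoord.
by apply/seteqP; split=> p /=; rewrite /slit_tangent/= dot_gt0 -enorm_lt.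
Qed.

Lemma regular_slit : regular `<=` slit_tangent (cylinder rho).
Proof.
move=> p [/andP[_ pr] p2]; split=> //=.
by apply: contra_neq p2 => ->; exact: space0.
Qed.

End domains.

Section phi_smooth.
Variables (R : realType) (n : nat) (rho : R) (F : tangent R n.+1 -> R)
    (phi : R -> R -> R).
Hypothesis rho0 : 0 < rho.
Hypothesis hF : is_finsler (cylinder rho) F.
Hypothesis hform : has_cyl_form rho F phi.

Let e1 : 'rV[R]_n.+2 := delta_mx ord0 (lift ord0 ord0).
Let e0 : 'rV[R]_n.+2 := delta_mx ord0 ord0.

(** The affine plane xbar = r e_1, y = (z, e_1), on which F^2 = phi(z, r) since
    |ybar| = 1. *)
Definition slice_pt (z r : R) : tangent R n.+1 := (r *: e1, z *: e0 + e1).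

Lemma slice_coords z r : 0 <= r ->
  [/\ xnorm (slice_pt z r) = r, ynorm (slice_pt z r) = 1 &
      slope (slice_pt z r) = z].
Proof.
move=> r0.
have s1 : ynorm (slice_pt z r) = 1.
  rewrite /ynorm /slice_pt /= space_lin space_delta0 scaler0 add0r space_delta.
  by rewrite -[delta_mx _ _]scale1r enormZ_delta.
split=> //; last first.
  by rewrite /slope s1 divr1 /slice_pt /= time_lin time_delta0 time_delta mulr1 addr0.
rewrite /xnorm /slice_pt /= -[r *: _]addr0 space_lin space_delta space0 addr0.
exact: enormZ_delta.
Qed.

Lemma slice_regular z r : 0 < r < rho -> regular rho (slice_pt z r).
Proof.
move=> /andP[r0 rr]; have [er es _] := slice_coords z (ltW r0); split.
  by rewrite er r0.
by rewrite -enorm_gt0 -/(ynorm _) es.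
Qed.

(** A nonpositive value of phi would make the square root vanish, against the
    definiteness of [F]. *)
Lemma phi_gt0_sqF p : regular rho p ->
  0 < phi (slope p) (xnorm p) /\
  sqF F p = ynorm p ^+ 2 * phi (slope p) (xnorm p).
Proof.
case: p => x y Op; have [xM y0] := regular_slit Op; have [/andP[/= r0 rr] sy0] := Op.
have [_ _ FE0 _ _] := hF.
have FE := hform xM sy0.
have p0 : 0 < phi (slope (x, y)) (xnorm (x, y)).
  rewrite ltNge; apply: contraNN y0 => ple0.
  by apply/eqP/(FE0 x y xM); rewrite FE ler0_sqrtr ?mulr0.
by split=> //; rewrite /sqF FE exprMn (sqr_sqrtr (ltW p0)).
Qed.

Lemma smooth_sqF : smooth_on (slit_tangent (cylinder rho)) (sqF F).
Proof. by apply: smoothX; [exact: open_slit|have [] := hF]. Qed.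

(** On the slice, phi is F^2 composed with an affine map. *)
Lemma smooth_phi : smooth_on (strip rho) (fun q : R * R => phi q.1 q.2).
Proof.
pose a (q : R * R) := slice_pt q.1 q.2.
have sFa : smooth_on (a @^-1` slit_tangent (cylinder rho)) (sqF F \o a).
  apply: (smooth_affine (l := fun q : R * R => (q.2 *: e1, q.1 *: e0))) => [h p v|p|].
  - rewrite /a /slice_pt; congr pair => /=.
      by rewrite scalerDl scalerA.
    by rewrite scalerDl scalerA addrA.
  - apply: differentiable_pair.
      by apply: differentiableZl; exact: differentiable_snd.
    apply: differentiableD => //.
    by apply: differentiableZl; exact: differentiable_fst.
  - exact: smooth_sqF.
have := smooth_sub _ sFa => /(_ (strip rho)) H.
apply: smooth_eq (H _); first exact: open_strip.
  move=> [z r] /= zr; have [r0 _] := andP zr.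
  have [_ ->] := phi_gt0_sqF (slice_regular z zr).
  by have [-> -> ->] := slice_coords z (ltW r0); rewrite expr1n mul1r.
by move=> [z r] /= zr; exact/regular_slit/slice_regular.
Qed.

Lemma phi_gt0 z r : 0 < r < rho -> 0 < phi z r.
Proof.
move=> zr; have [r0 _] := andP zr.
have [+ _] := phi_gt0_sqF (slice_regular z zr).
by have [-> _ ->] := slice_coords z (ltW r0).
Qed.

End phi_smooth.

(** * Smooth functions of (z, r) *)

Definition strip_smooth (R : realType) (rho : R) (H : R -> R -> R) : Prop :=
  smooth_on (strip rho) (fun q : R * R => H q.1 q.2).

Section strip_smooth.
Variables (R : realType) (rho : R).
Implicit Types (H G : R -> R -> R).

Lemma strip_smooth_cst (c : R) : strip_smooth rho (fun _ _ => c).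
Proof. exact: smooth_cst. Qed.

Lemma strip_smooth_z : strip_smooth rho (fun z _ => z).
Proof.
apply: smooth_lin => //; first exact: open_strip.
by move=> p; exact: differentiable_fst.
Qed.

Lemma strip_smooth_r : strip_smooth rho (fun _ r => r).
Proof.
apply: smooth_lin => //; first exact: open_strip.
by move=> p; exact: differentiable_snd.
Qed.

Lemma strip_smoothD H G : strip_smooth rho H -> strip_smooth rho G ->
  strip_smooth rho (fun z r => H z r + G z r).
Proof. by apply: smoothD; exact: open_strip. Qed.

Lemma strip_smoothN H : strip_smooth rho H -> strip_smooth rho (fun z r => - H z r).
Proof. by apply: smoothN; exact: open_strip. Qed.

Lemma strip_smoothM H G : strip_smooth rho H -> strip_smooth rho G ->
  strip_smooth rho (fun z r => H z r * G z r).
Proof. by apply: smoothM; exact: open_strip. Qed.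

Lemma strip_smoothX H k : strip_smooth rho H -> strip_smooth rho (fun z r => H z r ^+ k).
Proof. by apply: smoothX; exact: open_strip. Qed.

Lemma strip_smoothV H : (forall z r, 0 < r < rho -> H z r != 0) -> strip_smooth rho H ->
  strip_smooth rho (fun z r => (H z r)^-1).
Proof. by move=> H0; apply: smoothV; [exact: open_strip|move=> [z r]; exact: H0]. Qed.

Lemma strip_smooth_dz H : strip_smooth rho H -> strip_smooth rho (dz H).
Proof.
move=> /(@smooth_derive _ _ _ _ ((1, 0) : R * R)).
by congr smooth_on; apply/funext => -[z r]; rewrite dzE.
Qed.

Lemma strip_smooth_dr H : strip_smooth rho H -> strip_smooth rho (dr H).
Proof.
move=> /(@smooth_derive _ _ _ _ ((0, 1) : R * R)).
by congr smooth_on; apply/funext => -[z r]; rewrite drE.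
Qed.

End strip_smooth.

(** Reduces smoothness of an expression in (z, r) to that of its atoms, leaving the
    nonvanishing of denominators. *)
Ltac strip_smooth_step := match goal with
  | |- strip_smooth _ (fun z r => @?f z r + @?g z r) => apply: (@strip_smoothD _ _ f g)
  | |- strip_smooth _ (fun z r => - @?f z r) => apply: (@strip_smoothN _ _ f)
  | |- strip_smooth _ (fun z r => @?f z r * @?g z r) => apply: (@strip_smoothM _ _ f g)
  | |- strip_smooth _ (fun z r => (@?f z r) ^+ _) => apply: (@strip_smoothX _ _ f)
  | |- strip_smooth _ (fun z r => (@?f z r)^-1) => apply: (@strip_smoothV _ _ f)
  | |- strip_smooth _ (fun z r => z) => exact: strip_smooth_z
  | |- strip_smooth _ (fun z r => r) => exact: strip_smooth_r
  | |- strip_smooth _ (fun z r => dz _ z r) => apply: strip_smooth_dz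
  | |- strip_smooth _ (fun z r => dr _ z r) => apply: strip_smooth_dr
  | |- strip_smooth _ (dz _) => apply: strip_smooth_dz
  | |- strip_smooth _ (dr _) => apply: strip_smooth_dr
  | |- strip_smooth _ (fun z r => _) => exact: strip_smooth_cst
  | _ => eassumption
  end.

(** * First and second derivatives of the squared metric *)

Definition pullzr (R : realType) (n : nat) (H : R -> R -> R) (p : tangent R n) : R :=
  H (slope p) (xnorm p).

Lemma row0E (R : realType) n (i : 'I_n) : (0 : 'rV[R]_n) ord0 i = 0.
Proof. by rewrite mxE. Qed.

Lemma row_deltaE (R : realType) n (i j : 'I_n) :
  (delta_mx ord0 i : 'rV[R]_n) ord0 j = (j == i)%:R.
Proof. by rewrite mxE eqxx. Qed.

(** Evaluates the coordinates of the basis directions in derivatives computed by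
    the general rules. *)
Definition dirE := (time_delta0, time_delta, space_delta0, space_delta, time0,
  space0, dot0r, dot0l, dot_deltar, dot_deltal,
  row0E, row_deltaE).

Section pullback.
Variables (R : realType) (n : nat) (rho : R).
Implicit Types (p v : tangent R n) (H : R -> R -> R).

Lemma regular_xneq0 p : regular rho p -> space p.1 != 0.
Proof. by move=> [/andP[+ _] _]; rewrite enorm_gt0. Qed.

Lemma dir_pullzr H p v : strip_smooth rho H -> regular rho p ->
  is_derive p v (pullzr (n := n) H)
    (pullzr (dz H) p *
       (time v.2 / ynorm p - slope p * dot (space p.2) (space v.2) / ynorm p ^+ 2) +
     pullzr (dr H) p * (dot (space p.1) (space v.1) / xnorm p)).
Proof.
move=> sH Op; have [pr p2] := Op; apply: dir_chain.
- exact: smooth_differentiable sH _.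
- exact: dir_slope.
- exact/dir_xnorm/regular_xneq0.
Qed.

End pullback.

(** One differentiation rule for each operation and each coordinate. *)
Ltac dirstep :=
  match goal with
  | |- is_derive _ _ (fun q => @?f q + @?g q) _ => eapply (dirD (f := f) (g := g))
  | |- is_derive _ _ (fun q => - @?f q) _ => eapply (dirN (f := f))
  | |- is_derive _ _ (fun q => @?f q * @?g q) _ => eapply (dirM (f := f) (g := g))
  | |- is_derive _ _ (fun q => (@?f q) ^+ _) _ => eapply (dirX (f := f))
  | |- is_derive _ _ (fun q => (@?f q)^-1) _ => eapply (dirV (f := f))
  | |- is_derive _ _ (fun q => ynorm q) _ => apply dir_ynorm
  | |- is_derive _ _ ynorm _ => apply dir_ynorm
  | |- is_derive _ _ xnorm _ => apply dir_xnorm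
  | |- is_derive _ _ slope _ => apply dir_slope
  | |- is_derive _ _ xydot _ => apply dir_xydot
  | |- is_derive _ _ (pullzr _) _ => eapply dir_pullzr
  | |- is_derive _ _ (fun q => xnorm q) _ => apply dir_xnorm
  | |- is_derive _ _ (fun q => slope q) _ => apply dir_slope
  | |- is_derive _ _ (fun q => xydot q) _ => apply dir_xydot
  | |- is_derive _ _ (fun q => pullzr _ q) _ => eapply dir_pullzr
  | |- is_derive _ _ (fun q => time q.2) _ => apply dir_time
  | |- is_derive _ _ (fun q => fun_of_matrix (Defs.space (snd q)) _ ?i) _ => apply (dir_y i)
  | |- is_derive _ _ (fun q => fun_of_matrix (Defs.space (fst q)) _ ?i) _ => apply (dir_x i)
  | |- is_derive _ _ (fun q => _) _ => apply dir_cst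
  end.

Ltac dirs := eapply is_derive_eq; [repeat dirstep; try eassumption; repeat strip_smooth_step
   | rewrite /= !dirE].

(** Abstracts each coordinate and each function of (z, r), which leaves a rational
    identity between variables. *)
Ltac atoms p :=
  repeat match goal with |- context [pullzr ?H p] => generalize (pullzr H p) end;
  repeat match goal with |- context [fun_of_matrix (Defs.space ?a) ?i ?j] =>
    generalize (fun_of_matrix (Defs.space a) i j) end;
  generalize dependent (ynorm p); generalize dependent (xnorm p);
  generalize (slope p); generalize (xydot p); intros.

Ltac dfield p := atoms p; field; repeat (apply/andP; split); eassumption.

Section metric_derivatives.
Variables (R : realType) (n : nat) (rho : R) (F : tangent R n -> R)
    (phi : R -> R -> R).
Hypothesis rho0 : 0 < rho.
Hypothesis sphi : strip_smooth rho phi.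
Hypothesis FE : forall p, regular rho p -> sqF F p = ynorm p ^+ 2 * pullzr phi p.

Let Om := @open_regular R n rho rho0.

Lemma dir_dy A f p d :
  is_derive p ((0, delta_mx ord0 A) : tangent R n) f d -> dy A f p = d.
Proof. by move=> [_ <-]. Qed.

Lemma dir_dx A f p d :
  is_derive p ((delta_mx ord0 A, 0) : tangent R n) f d -> dx A f p = d.
Proof. by move=> [_ <-]. Qed.

Lemma dy_eq A f g (U : set (tangent R n)) : open U -> (forall p, U p -> f p = g p) ->
  forall p, U p -> dy A f p = dy A g p.
Proof. exact: derive_eq_on. Qed.

Lemma dx_eq A f g (U : set (tangent R n)) : open U -> (forall p, U p -> f p = g p) ->
  forall p, U p -> dx A f p = dx A g p.
Proof. exact: derive_eq_on. Qed.

Lemma dy_regular A f g p d : (forall p, regular rho p -> f p = g p) ->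
  regular rho p ->
  is_derive p ((0, delta_mx ord0 A) : tangent R n) g d -> dy A f p = d.
Proof. by move=> fg Op gd; rewrite (dy_eq A Om fg Op); exact: dir_dy. Qed.

Lemma dx_regular A f g p d : (forall p, regular rho p -> f p = g p) ->
  regular rho p ->
  is_derive p ((delta_mx ord0 A, 0) : tangent R n) g d -> dx A f p = d.
Proof. by move=> fg Op gd; rewrite (dx_eq A Om fg Op); exact: dir_dx. Qed.

Lemma regularP (p : tangent R n) : regular rho p ->
  [/\ space p.1 != 0, space p.2 != 0, xnorm p != 0 & ynorm p != 0].
Proof.
move=> Op; have [/andP[r0 _] p2] := Op.
by split=> //; [exact: regular_xneq0 Op|exact: lt0r_neq0|exact: ynorm_neq0].
Qed.

Lemma dy0_sqF p : regular rho p ->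
  dy ord0 (sqF F) p = ynorm p * pullzr (dz phi) p.
Proof.
move=> Op; have [p1 p2 x0 y0] := regularP Op.
refine (dy_regular FE Op _); dirs.
dfield p.
Qed.

Lemma dyi_sqF (i : 'I_n) p : regular rho p ->
  dy (lift ord0 i) (sqF F) p =
  space p.2 ord0 i * (2 * pullzr phi p - slope p * pullzr (dz phi) p).
Proof.
move=> Op; have [p1 p2 x0 y0] := regularP Op.
refine (dy_regular FE Op _); dirs.
dfield p.
Qed.

Lemma dx0_sqF p : regular rho p -> dx ord0 (sqF F) p = 0.
Proof.
move=> Op; have [p1 p2 x0 y0] := regularP Op.
refine (dx_regular FE Op _); dirs.
dfield p.
Qed.

Lemma dxi_sqF (i : 'I_n) p : regular rho p ->
  dx (lift ord0 i) (sqF F) p =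
  ynorm p ^+ 2 * pullzr (dr phi) p * space p.1 ord0 i / xnorm p.
Proof.
move=> Op; have [p1 p2 x0 y0] := regularP Op.
refine (dx_regular FE Op _); dirs.
dfield p.
Qed.

Lemma dy00_sqF p : regular rho p ->
  dy ord0 (dy ord0 (sqF F)) p = pullzr (dz (dz phi)) p.
Proof.
move=> Op; have [p1 p2 x0 y0] := regularP Op.
refine (dy_regular dy0_sqF Op _); dirs.
dfield p.
Qed.

Lemma dyi0_sqF (i : 'I_n) p : regular rho p ->
  dy (lift ord0 i) (dy ord0 (sqF F)) p = space p.2 ord0 i / ynorm p *
    (pullzr (dz phi) p - slope p * pullzr (dz (dz phi)) p).
Proof.
move=> Op; have [p1 p2 x0 y0] := regularP Op.
refine (dy_regular dy0_sqF Op _); dirs.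
dfield p.
Qed.

Lemma dy0i_sqF (i : 'I_n) p : regular rho p ->
  dy ord0 (dy (lift ord0 i) (sqF F)) p = space p.2 ord0 i / ynorm p *
    (pullzr (dz phi) p - slope p * pullzr (dz (dz phi)) p).
Proof.
move=> Op; have [p1 p2 x0 y0] := regularP Op.
refine (dy_regular (dyi_sqF i) Op _); dirs.
dfield p.
Qed.

Lemma dyji_sqF (i j : 'I_n) p : regular rho p ->
  dy (lift ord0 j) (dy (lift ord0 i) (sqF F)) p =
  (i == j)%:R * (2 * pullzr phi p - slope p * pullzr (dz phi) p) -
  space p.2 ord0 i * space p.2 ord0 j / ynorm p ^+ 2 *
    (slope p * (pullzr (dz phi) p - slope p * pullzr (dz (dz phi)) p)).
Proof.
move=> Op; have [p1 p2 x0 y0] := regularP Op.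
refine (dy_regular (dyi_sqF i) Op _); dirs.
dfield p.
Qed.

Lemma dx0y_sqF A p : regular rho p -> dx ord0 (dy A (sqF F)) p = 0.
Proof.
move=> Op; have [p1 p2 x0 y0] := regularP Op.
case: (unliftP ord0 A) => [i|] ->.
  refine (dx_regular (dyi_sqF i) Op _); dirs.
  dfield p.
refine (dx_regular dy0_sqF Op _); dirs.
dfield p.
Qed.

Lemma dxiy0_sqF (i : 'I_n) p : regular rho p ->
  dx (lift ord0 i) (dy ord0 (sqF F)) p =
  ynorm p * pullzr (dr (dz phi)) p * space p.1 ord0 i / xnorm p.
Proof.
move=> Op; have [p1 p2 x0 y0] := regularP Op.
refine (dx_regular dy0_sqF Op _); dirs.
dfield p.
Qed.

Lemma dxjyi_sqF (i j : 'I_n) p : regular rho p ->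
  dx (lift ord0 j) (dy (lift ord0 i) (sqF F)) p =
  space p.2 ord0 i * (2 * pullzr (dr phi) p - slope p * pullzr (dr (dz phi)) p) *
  space p.1 ord0 j / xnorm p.
Proof.
move=> Op; have [p1 p2 x0 y0] := regularP Op.
refine (dx_regular (dyi_sqF i) Op _); dirs.
dfield p.
Qed.
End metric_derivatives.

(** * The fundamental tensor *)

(** A nonzero vector of the left kernel would be isotropic. *)
Lemma posdef_unitmx (R : realType) (n : nat) (M : 'M[R]_n) :
  (forall w : 'rV[R]_n, w != 0 ->
     0 < \sum_A \sum_B M A B * w ord0 A * w ord0 B) -> M \in unitmx.
Proof.
move=> Mpos; rewrite -row_free_unit -kermx_eq0; apply/rowV0P => v /sub_kermxP vM.
apply/eqP/negPn/negP => /Mpos.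
rewrite exchange_big /= big1 ?ltxx// => B _.
rewrite -mulr_suml; under eq_bigr do rewrite mulrC.
by move/rowP: vM => /(_ B); rewrite !mxE => ->; rewrite mul0r.
Qed.

(** The part of the spray coefficients that multiplies t y^A. It solves, with U,
    the system phi_z U + 2 phi V = phi_r / 2r and phi_zz U + phi_z V = phi_zr / 2r. *)
Definition cylV (R : realType) (phi : R -> R -> R) : R -> R -> R :=
  fun z r => (dr phi z r / (2 * r) - dz phi z r * cylU phi z r) / (2 * phi z r).

Section metric.
Variables (R : realType) (n : nat) (rho : R) (F : tangent R n -> R)
    (phi : R -> R -> R).
Hypothesis rho0 : 0 < rho.
Hypothesis sphi : strip_smooth rho phi.
Hypothesis FE : forall p, regular rho p -> sqF F p = ynorm p ^+ 2 * pullzr phi p.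

Let P0 (p : tangent R n) := pullzr phi p.
Let Pz (p : tangent R n) := pullzr (dz phi) p.
Let Pzz (p : tangent R n) := pullzr (dz (dz phi)) p.
Let N p := 2 * P0 p - slope p * Pz p.
Let K p := Pz p - slope p * Pzz p.

(** On the space directions the tensor is a multiple of the identity plus terms in
    ybar, so its products with [w] only see w^0, ybar.w and, in row j, w^j. *)
Lemma fund_row0 p (w : 'rV[R]_n.+1) : regular rho p ->
  \sum_A fundamental F p ord0 A * w ord0 A =
  2^-1 * (Pzz p * time w + K p / ynorm p * dot (space p.2) (space w)).
Proof.
move=> Op; rewrite big_ord_recl mxE (dy00_sqF rho0 sphi FE Op) -/(time w).
rewrite mulrDr mulrA; congr (_ + _).
rewrite /dot mulr_sumr mulr_sumr; apply: eq_bigr => i _.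
by rewrite mxE (dyi0_sqF rho0 sphi FE i Op) [space w _ _]mxE -/(Pz p) -/(Pzz p) -/(K p); ring.
Qed.

Lemma fund_rowi p (w : 'rV[R]_n.+1) (j : 'I_n) : regular rho p ->
  \sum_A fundamental F p (lift ord0 j) A * w ord0 A =
  2^-1 * (K p / ynorm p * space p.2 ord0 j * time w + N p * space w ord0 j -
    space p.2 ord0 j * slope p * K p / ynorm p ^+ 2 * dot (space p.2) (space w)).
Proof.
move=> Op; rewrite big_ord_recl mxE (dy0i_sqF rho0 sphi FE j Op) -/(time w).
have e i : fundamental F p (lift ord0 j) (lift ord0 i) * w ord0 (lift ord0 i) =
    2^-1 * N p * ((j == i)%:R * space w ord0 i) -
    2^-1 * (space p.2 ord0 j * slope p * K p / ynorm p ^+ 2) *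
      (space p.2 ord0 i * space w ord0 i).
  rewrite mxE (dyji_sqF rho0 sphi FE j i Op) [space w _ _]mxE.
  by rewrite -/(Pz p) -/(Pzz p) -/(K p) -/(P0 p) -/(N p); ring.
under eq_bigr do rewrite e.
rewrite sumrB -!mulr_sumr -/(dot _ _) (bigD1 j)//= eqxx mul1r big1 ?addr0.
  by rewrite -/(Pz p) -/(Pzz p) -/(K p); ring.
by move=> i; rewrite eq_sym => /negPf ->; rewrite mul0r.
Qed.

Lemma fund_quad p (w : 'rV[R]_n.+1) : regular rho p ->
  2 * \sum_A \sum_B fundamental F p A B * w ord0 A * w ord0 B =
  Pzz p * time w ^+ 2 + 2 * K p / ynorm p * time w * dot (space p.2) (space w) +
  N p * dot (space w) (space w) -
  slope p * K p * dot (space p.2) (space w) ^+ 2 / ynorm p ^+ 2.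
Proof.
move=> Op.
have e A : \sum_B fundamental F p A B * w ord0 A * w ord0 B =
    w ord0 A * \sum_B fundamental F p A B * w ord0 B.
  by rewrite mulr_sumr; apply: eq_bigr => B _; ring.
under eq_bigr do rewrite e.
rewrite big_ord_recl (fund_row0 w Op) -/(time w).
have {}e j : w ord0 (lift ord0 j) *
    \sum_B fundamental F p (lift ord0 j) B * w ord0 B =
    2^-1 * (K p / ynorm p * time w) * (space p.2 ord0 j * space w ord0 j) +
    2^-1 * N p * (space w ord0 j * space w ord0 j) -
    2^-1 * (slope p * K p / ynorm p ^+ 2 * dot (space p.2) (space w)) *
      (space p.2 ord0 j * space w ord0 j).
  by rewrite (fund_rowi w j Op) [space w ord0 j]mxE; ring.
under eq_bigr do rewrite e.
rewrite sumrB big_split /= -!mulr_sumr -/(dot _ _) -/(dot _ _).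
have [_ _ _ y0] := regularP Op.
by field.
Qed.

Hypothesis gpos : forall p, regular rho p -> forall w : 'rV[R]_n.+1, w != 0 ->
  0 < \sum_A \sum_B fundamental F p A B * w ord0 A * w ord0 B.

(** Up to the positive factor s^2 phi this is the quadratic form at the vector
    (s (2 phi - z phi_z), - phi_z ybar). *)
Lemma cyl_hess_gt0 p : regular rho p -> 0 < P0 p ->
  0 < 2 * P0 p * Pzz p - Pz p ^+ 2.
Proof.
move=> Op ph0; have [_ p2 _ y0] := regularP Op.
pose w : 'rV[R]_n.+1 := \row_A (if A == ord0 then ynorm p * (2 * P0 p - slope p * Pz p)
   else - Pz p * p.2 ord0 A).
have tw : time w = ynorm p * (2 * P0 p - slope p * Pz p) by rewrite /time mxE eqxx.
have sw : space w = - Pz p *: space p.2 by apply/rowP => i; rewrite !mxE.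
have w0 : w != 0.
  apply/eqP => w0; move: tw sw.
  rewrite w0 time0 space0 => /esym/eqP; rewrite mulf_eq0 (negPf y0)/= => N0.
  move/esym/eqP; rewrite scaler_eq0 (negPf p2) orbF oppr_eq0 => /eqP Pz0.
  by move: N0; rewrite Pz0 mulr0 subr0 mulf_eq0 pnatr_eq0 (gt_eqF ph0).
have := gpos Op w0; rewrite -(@pmulr_rgt0 _ 2)// (fund_quad w Op) tw sw.
rewrite !dotZr dotZl -/(dot _ _) -[dot _ _]enorm_sqr -/(ynorm p).
rewrite (_ : _ - _ = (ynorm p ^+ 2 * (2 * P0 p)) * (2 * P0 p * Pzz p - Pz p ^+ 2)).
  by rewrite pmulr_rgt0// mulr_gt0// ?exprn_gt0 ?mulr_gt0// lt_def y0 enorm_ge0.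
by rewrite /N /K; field.
Qed.

(** The quadratic form at (0, v) is half of this factor times |v|^2, when v is
    orthogonal to ybar. *)
Lemma cyl_N_gt0 p (v : 'rV[R]_n) : regular rho p -> v != 0 ->
  dot (space p.2) v = 0 -> 0 < N p.
Proof.
move=> Op v0 yv.
pose w : 'rV[R]_n.+1 := \row_A (if unlift ord0 A is Some i then v ord0 i else 0).
have tw : time w = 0 by rewrite /time mxE unlift_none.
have sw : space w = v by apply/rowP => i; rewrite !mxE liftK.
have w0 : w != 0 by apply: contra_neq v0 => w0; rewrite -sw w0 space0.
have := gpos Op w0; rewrite -(@pmulr_rgt0 _ 2)// (fund_quad w Op) tw sw yv.
rewrite expr0n !mulr0 mul0r subr0 !add0r.
by rewrite pmulr_lgt0// dot_gt0.
Qed.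
End metric.

(** Rotate the first two coordinates by a right angle; if they are both zero, the
    first basis vector is orthogonal. *)
Lemma exists_orthogonal (R : realType) (m : nat) (y : 'rV[R]_m.+2) :
  exists2 v, v != 0 & dot y v = 0.
Proof.
pose j : 'I_m.+2 := lift ord0 ord0.
pose v : 'rV[R]_m.+2 := y ord0 j *: delta_mx ord0 ord0 - y ord0 ord0 *: delta_mx ord0 j.
have yv : dot y v = 0.
  rewrite /v -scaleNr addrC /dot.
  under eq_bigr do rewrite mxE mulrDr.
  by rewrite big_split /= -/(dot _ _) -/(dot _ _) !dotZr !dot_deltar; ring.
have [v0|v0] := eqVneq v 0; last by exists v.
exists (delta_mx ord0 ord0).
  apply/eqP => /rowP /(_ ord0); rewrite !mxE !eqxx => /eqP.
  by rewrite oner_eq0.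
rewrite dot_deltar; move/rowP: v0 => /(_ j); rewrite !mxE !eqxx /=.
by rewrite mulr0 add0r mulr1 => /eqP; rewrite oppr_eq0 => /eqP.
Qed.

(** * Smoothness of U, V, W, R and T *)

Section smoothness_UVW.
Variables (R : realType) (rho : R) (phi : R -> R -> R).
Hypothesis sphi : strip_smooth rho phi.
Hypothesis phi0 : forall z r, 0 < r < rho -> 0 < phi z r.
Hypothesis N0 : forall z r, 0 < r < rho -> 0 < 2 * phi z r - z * dz phi z r.
Hypothesis hess0 : forall z r, 0 < r < rho ->
  0 < 2 * phi z r * dz (dz phi) z r - dz phi z r ^+ 2.

Lemma strip_smooth_U : strip_smooth rho (cylU phi).
Proof.
rewrite /cylU; repeat strip_smooth_step.
move=> z r zr; rewrite !mulf_neq0//; first by have [/lt0r_neq0] := andP zr.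
exact/lt0r_neq0/hess0.
Qed.

Lemma strip_smooth_W : strip_smooth rho (cylW phi).
Proof.
rewrite /cylW; repeat strip_smooth_step.
move=> z r zr; rewrite !mulf_neq0//; first by have [/lt0r_neq0] := andP zr.
exact/lt0r_neq0/N0.
Qed.

Lemma strip_smooth_V : strip_smooth rho (cylV phi).
Proof.
have sU := strip_smooth_U.
rewrite /cylV; repeat strip_smooth_step.
- by move=> z r /andP[/lt0r_neq0 r0 _]; rewrite mulf_neq0.
- by move=> z r zr; rewrite mulf_neq0//; exact/lt0r_neq0/phi0.
Qed.

Lemma strip_smooth_T n : strip_smooth rho (cylT n phi).
Proof.
have sU := strip_smooth_U; have sW := strip_smooth_W.
by rewrite /cylT; repeat strip_smooth_step.
Qed.

Lemma strip_smooth_R n : strip_smooth rho (cylR n phi).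
Proof.
have sU := strip_smooth_U; have sW := strip_smooth_W.
by rewrite /cylR; repeat strip_smooth_step.
Qed.
End smoothness_UVW.

(** * The spray and its projective part *)

Section spray.
Variables (R : realType) (n : nat) (rho : R) (F : tangent R n -> R)
    (phi : R -> R -> R).
Hypothesis rho0 : 0 < rho.
Hypothesis sphi : strip_smooth rho phi.
Hypothesis FE : forall p, regular rho p -> sqF F p = ynorm p ^+ 2 * pullzr phi p.
Hypothesis gpos : forall p, regular rho p -> forall w : 'rV[R]_n.+1, w != 0 ->
  0 < \sum_A \sum_B fundamental F p A B * w ord0 A * w ord0 B.
Hypothesis phi0 : forall z r, 0 < r < rho -> 0 < phi z r.
Hypothesis N0 : forall z r, 0 < r < rho -> 0 < 2 * phi z r - z * dz phi z r.
Hypothesis hess0 : forall z r, 0 < r < rho ->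
  0 < 2 * phi z r * dz (dz phi) z r - dz phi z r ^+ 2.

Let sU : strip_smooth rho (cylU phi) := strip_smooth_U sphi hess0.
Let sV : strip_smooth rho (cylV phi) := strip_smooth_V sphi phi0 hess0.
Let sW : strip_smooth rho (cylW phi) := strip_smooth_W sphi N0.

(** The candidate solution of g G = b / 4, checked in [sprayE]. *)
Definition spray0 (p : tangent R n) : R :=
  ynorm p * xydot p * (pullzr (cylU phi) p + slope p * pullzr (cylV phi) p).

Definition sprayi (i : 'I_n) (p : tangent R n) : R :=
  xydot p * (pullzr (cylV phi) p + pullzr (cylW phi) p) * space p.2 ord0 i -
  ynorm p ^+ 2 * pullzr (cylW phi) p * space p.1 ord0 i.

Definition spray_row (p : tangent R n) : 'rV[R]_n.+1 :=
  \row_A (if unlift ord0 A is Some i then sprayi i p else spray0 p).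

Lemma spray_row0 p : time (spray_row p) = spray0 p.
Proof. by rewrite /time mxE unlift_none. Qed.

Lemma spray_rowi p i : space (spray_row p) ord0 i = sprayi i p.
Proof. by rewrite !mxE liftK. Qed.

(** In ybar.G the W terms cancel because ybar.(t ybar) = s^2 (ybar.xbar). *)
Lemma dot_spray_row p : dot (space p.2) (space (spray_row p)) =
  xydot p * pullzr (cylV phi) p * ynorm p ^+ 2.
Proof.
rewrite /dot.
have e i : space p.2 ord0 i * space (spray_row p) ord0 i =
    xydot p * (pullzr (cylV phi) p + pullzr (cylW phi) p) *
      (space p.2 ord0 i * space p.2 ord0 i) -
    ynorm p ^+ 2 * pullzr (cylW phi) p * (space p.2 ord0 i * space p.1 ord0 i).
  by rewrite spray_rowi /sprayi; ring.
under eq_bigr do rewrite e.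
by rewrite sumrB -!mulr_sumr xydot_sum ynorm_sum; ring.
Qed.

Let rhs p C := \sum_B dx B (dy C (sqF F)) p * p.2 ord0 B - dx C (sqF F) p.

Lemma rhs0 p : regular rho p ->
  rhs p ord0 = ynorm p * pullzr (dr (dz phi)) p * xydot p / xnorm p.
Proof.
move=> Op; rewrite /rhs big_ord_recl (dx0y_sqF rho0 sphi FE ord0 Op).
rewrite (dx0_sqF rho0 sphi FE Op) mul0r add0r subr0.
have e i : dx (lift ord0 i) (dy ord0 (sqF F)) p * p.2 ord0 (lift ord0 i) =
    ynorm p * pullzr (dr (dz phi)) p / xnorm p * (space p.2 ord0 i * space p.1 ord0 i).
  by rewrite (dxiy0_sqF rho0 sphi FE i Op) [space p.2 _ _]mxE; ring.
by under eq_bigr do rewrite e; rewrite -mulr_sumr xydot_sum; ring.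
Qed.

Lemma rhsi p j : regular rho p ->
  rhs p (lift ord0 j) = space p.2 ord0 j *
    (2 * pullzr (dr phi) p - slope p * pullzr (dr (dz phi)) p) * xydot p / xnorm p -
  ynorm p ^+ 2 * pullzr (dr phi) p * space p.1 ord0 j / xnorm p.
Proof.
move=> Op; rewrite /rhs big_ord_recl (dx0y_sqF rho0 sphi FE _ Op) mul0r add0r.
rewrite (dxi_sqF rho0 sphi FE j Op).
have e i : dx (lift ord0 i) (dy (lift ord0 j) (sqF F)) p * p.2 ord0 (lift ord0 i) =
    space p.2 ord0 j *
    (2 * pullzr (dr phi) p - slope p * pullzr (dr (dz phi)) p) / xnorm p *
    (space p.2 ord0 i * space p.1 ord0 i).
  by rewrite (dxjyi_sqF rho0 sphi FE j i Op) [space p.2 ord0 i]mxE; ring.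
by under eq_bigr do rewrite e; rewrite -mulr_sumr xydot_sum; ring.
Qed.

(** As the fundamental tensor is invertible, it suffices that the candidate solves
    the linear system. *)
Lemma sprayE C p : regular rho p -> spray F C p = spray_row p ord0 C.
Proof.
move=> Op; have [_ _ x0 y0] := regularP Op; have [pr _] := Op.
have a0 : pullzr phi p != 0 by exact/lt0r_neq0/phi0.
have b0 : 2 * pullzr phi p - slope p * pullzr (dz phi) p != 0 by exact/lt0r_neq0/N0.
have c0 : 2 * pullzr phi p * pullzr (dz (dz phi)) p - pullzr (dz phi) p ^+ 2 != 0.
  exact/lt0r_neq0/hess0.
have gG : fundamental F p *m (spray_row p)^T = \col_C (4^-1 * rhs p C).
  apply/colP => A; rewrite mxE [RHS]mxE.
  under eq_bigr do rewrite [_^T _ _]mxE.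
  case: (unliftP ord0 A) => [j|] ->.
    rewrite (fund_rowi rho0 sphi FE (spray_row p) j Op) dot_spray_row spray_row0.
    rewrite spray_rowi (rhsi j Op) /sprayi /spray0.
    have -> : pullzr (cylV phi) p = (pullzr (dr phi) p / (2 * xnorm p) -
      pullzr (dz phi) p * pullzr (cylU phi) p) / (2 * pullzr phi p) by [].
    have -> : pullzr (cylU phi) p = (2 * pullzr phi p * pullzr (dr (dz phi)) p -
       pullzr (dz phi) p * pullzr (dr phi) p) / (2 * xnorm p *
       (2 * pullzr phi p * pullzr (dz (dz phi)) p - pullzr (dz phi) p ^+ 2)) by [].
    have -> : pullzr (cylW phi) p = pullzr (dr phi) p / (2 * xnorm p *
        (2 * pullzr phi p - slope p * pullzr (dz phi) p)) by [].
    move: a0 b0 c0.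
    dfield p.
  rewrite (fund_row0 rho0 sphi FE (spray_row p) Op) dot_spray_row spray_row0.
  rewrite (rhs0 Op) /spray0.
  have -> : pullzr (cylV phi) p = (pullzr (dr phi) p / (2 * xnorm p) -
      pullzr (dz phi) p * pullzr (cylU phi) p) / (2 * pullzr phi p) by [].
  have -> : pullzr (cylU phi) p = (2 * pullzr phi p * pullzr (dr (dz phi)) p -
       pullzr (dz phi) p * pullzr (dr phi) p) / (2 * xnorm p *
       (2 * pullzr phi p * pullzr (dz (dz phi)) p - pullzr (dz phi) p ^+ 2)) by [].
  move: a0 b0 c0.
  dfield p.
have ug := posdef_unitmx (gpos Op).
have := congr1 (mulmx (invmx (fundamental F p))) gG; rewrite mulKmx//.
move=> /colP /(_ C); rewrite !mxE => ->.
rewrite /spray mulr_sumr; apply: eq_bigr => A _.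
by rewrite mxE mulrCA.
Qed.

Lemma spray0E p : regular rho p -> spray F ord0 p = spray0 p.
Proof. by move=> Op; rewrite sprayE// -spray_row0. Qed.

Lemma sprayiE i p : regular rho p -> spray F (lift ord0 i) p = sprayi i p.
Proof. by move=> Op; rewrite sprayE// -spray_rowi [RHS]mxE. Qed.

Lemma dy0_spray0 p : regular rho p -> dy ord0 (spray F ord0) p =
  xydot p * (pullzr (dz (cylU phi)) p + pullzr (cylV phi) p +
             slope p * pullzr (dz (cylV phi)) p).
Proof.
move=> Op; have [p1 p2 x0 y0] := regularP Op.
refine (dy_regular rho0 spray0E Op _); rewrite /spray0; dirs; dfield p.
Qed.

Lemma dyi_sprayi i p : regular rho p -> dy (lift ord0 i) (spray F (lift ord0 i)) p =
  (pullzr (cylV phi) p - pullzr (cylW phi) p + slope p * pullzr (dz (cylW phi)) p) *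
    (space p.2 ord0 i * space p.1 ord0 i) -
  slope p * xydot p * (pullzr (dz (cylV phi)) p + pullzr (dz (cylW phi)) p) /
    ynorm p ^+ 2 * (space p.2 ord0 i * space p.2 ord0 i) +
  xydot p * (pullzr (cylV phi) p + pullzr (cylW phi) p).
Proof.
move=> Op; have [p1 p2 x0 y0] := regularP Op.
refine (dy_regular rho0 (sprayiE i) Op _); rewrite /sprayi; dirs.
by rewrite eqxx /=; dfield p.
Qed.

Lemma spray_div p : regular rho p -> \sum_E dy E (spray F E) p =
  xydot p * (pullzr (dz (cylU phi)) p + n.+2%:R * pullzr (cylV phi) p +
    (n%:R - 1) * pullzr (cylW phi) p).
Proof.
move=> Op; have [p1 p2 x0 y0] := regularP Op.
rewrite big_ord_recl dy0_spray0//.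
under eq_bigr do rewrite dyi_sprayi//.
rewrite big_split /= sumrB -!mulr_sumr xydot_sum ynorm_sum sumr_const card_ord.
rewrite -[n.+2]addn2 natrD.
by dfield p.
Qed.

(** The function whose third derivatives in y are the Douglas tensor. *)
Definition proj_spray A (p : tangent R n) : R :=
  spray F A p - (n.+2%:R)^-1 * (\sum_E dy E (spray F E) p) * p.2 ord0 A.

Definition proj0 (p : tangent R n) : R := ynorm p * xydot p * pullzr (cylR n phi) p.
Definition proji (i : 'I_n) (p : tangent R n) : R :=
  xydot p * pullzr (cylT n phi) p * space p.2 ord0 i -
  ynorm p ^+ 2 * pullzr (cylW phi) p * space p.1 ord0 i.

(** The divergence is t (U_z + (n+2) V + (n-1) W), so that the terms in V cancel. *)
Lemma proj_spray0 p : regular rho p -> proj_spray ord0 p = proj0 p.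
Proof.
move=> Op; have [p1 p2 x0 y0] := regularP Op.
rewrite /proj_spray spray0E// spray_div// /proj0 /spray0.
have -> : p.2 ord0 ord0 = slope p * ynorm p by rewrite /slope divfK.
have -> : pullzr (cylR n phi) p = pullzr (cylU phi) p - slope p / n.+2%:R *
  (pullzr (dz (cylU phi)) p + (n%:R - 1) * pullzr (cylW phi) p) by [].
have m0 : n.+2%:R != 0 :> R by rewrite pnatr_eq0.
move: (n.+2%:R) m0 (n%:R : R) => m m0 c; dfield p.
Qed.

Lemma proj_sprayi i p : regular rho p -> proj_spray (lift ord0 i) p = proji i p.
Proof.
move=> Op; have [p1 p2 x0 y0] := regularP Op.
rewrite /proj_spray sprayiE// spray_div// /proji /sprayi.
have -> : p.2 ord0 (lift ord0 i) = space p.2 ord0 i by rewrite mxE.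
have -> : pullzr (cylT n phi) p = (n.+2%:R)^-1 *
  (3 * pullzr (cylW phi) p - pullzr (dz (cylU phi)) p) by [].
have m0 : n.+2%:R != 0 :> R by rewrite pnatr_eq0.
have -> : (n%:R - 1 : R) = n.+2%:R - 3 by rewrite -[n.+2]addn2 natrD; ring.
move: (n.+2%:R) m0 => m m0; dfield p.
Qed.

End spray.

(** * Differential conditions in z *)

Lemma is_derive_dz (R : realType) (rho : R) (H : R -> R -> R) (z r : R) :
  strip_smooth rho H -> 0 < r < rho -> is_derive z (1 : R) (H ^~ r) (dz H z r).
Proof.
move=> sH zr; have dH : differentiable (fun q : R * R => H q.1 q.2) ((z, r) : R * R).
  exact: smooth_differentiable sH _.
have := @dir_chain R R H id (fun=> r) z (1 : R) 1 0 dH (is_derive_id _ _) (dir_cst _ _ _).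
by rewrite mulr1 mulr0 addr0.
Qed.

(** Only z = 0 is in doubt; there, the derivative of z H(z), which is zero, is H(0). *)
Lemma mulz_eq0 (R : realType) (rho : R) (H : R -> R -> R) (r : R) :
  strip_smooth rho H -> 0 < r < rho -> (forall z, z * H z r = 0) -> forall z, H z r = 0.
Proof.
move=> sH zr zH z; have [->|z0] := eqVneq z 0; last first.
  by have /eqP := zH z; rewrite mulf_eq0 (negPf z0) => /eqP.
have [_ e] := dirM (is_derive_id (0 : R) (1 : R)) (is_derive_dz 0 sH zr).
move: e; rewrite (_ : (fun q => _) = cst 0); last by apply/funext => q; exact: zH.
by rewrite derive_cst mul0r addr0 mul1r.
Qed.

Lemma dz_eq0_cst (R : realType) (rho : R) (H : R -> R -> R) (r : R) :
  strip_smooth rho H -> 0 < r < rho -> (forall z, dz H z r = 0) ->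
  forall z, H z r = H 0 r.
Proof.
move=> sH zr H0 z; apply: (@is_derive_0_is_cst R (H ^~ r)) => u.
by have := is_derive_dz u sH zr; rewrite H0.
Qed.

(** Differentiating H = z H_z gives z H_zz = 0, so H_z is constant. *)
Lemma euler_linear (R : realType) (rho : R) (H : R -> R -> R) (r : R) :
  strip_smooth rho H -> 0 < r < rho -> (forall z, H z r - z * dz H z r = 0) ->
  forall z, H z r = z * dz H 0 r.
Proof.
move=> sH zr HE.
have sHz := strip_smooth_dz sH; have sHzz := strip_smooth_dz sHz.
have Hzz0 : forall z, dz (dz H) z r = 0.
  apply: (mulz_eq0 sHzz zr) => z.
  have [_ e] := dirD (is_derive_dz z sH zr)
    (dirN (dirM (is_derive_id (z : R) (1 : R)) (is_derive_dz z sHz zr))).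
  move: e; rewrite (_ : (fun q => _) = cst 0); last by apply/funext => q; exact: HE.
  by rewrite derive_cst mul1r opprD addrA subrr add0r => /eqP; rewrite eq_sym oppr_eq0 => /eqP.
by move=> z; rewrite -(dz_eq0_cst sHz zr Hzz0 z); apply/eqP; rewrite -subr_eq0 HE.
Qed.

(** The derivative H_z is linear by [euler_linear]. *)
Lemma euler_quadratic (R : realType) (rho : R) (H : R -> R -> R) (r : R) :
  strip_smooth rho H -> 0 < r < rho ->
  (forall z, dz H z r - z * dz (dz H) z r = 0) ->
  forall z, H z r = H 0 r + z ^+ 2 * (dz (dz H) 0 r / 2).
Proof.
move=> sH zr HE z.
have sHz := strip_smooth_dz sH.
have Hz := euler_linear sHz zr HE.
set c := dz (dz H) 0 r in Hz *.
suff : H z r - z ^+ 2 * (c / 2) = H 0 r - 0 ^+ 2 * (c / 2).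
  by rewrite expr0n mul0r subr0 => <-; rewrite subrK.
apply: (@is_derive_0_is_cst R (fun z => H z r - z ^+ 2 * (c / 2))) => u.
eapply is_derive_eq.
  exact: (dirD (is_derive_dz u sH zr)
    (dirN (dirM (dirX 1 (is_derive_id (u : R) (1 : R))) (dir_cst u (1 : R) (c / 2))))).
by rewrite Hz; field.
Qed.

Section third_derivative.
Variable R : realType.

Lemma derive1_is (f df : R -> R) : (forall x, is_derive x (1 : R) f (df x)) ->
  derive1 f = df.
Proof. by move=> H; apply/funext => x; rewrite derive1E; have [_ ->] := H x. Qed.

(** Two differentiations give 3 x k + x^2 k', whose derivative at 0 does not see the
    second term. *)
Lemma third_derivative_mulx (f k k1 : R -> R) :
  (forall x, is_derive x (1 : R) f (x * k x)) ->
  (forall x, is_derive x (1 : R) k (k1 x)) ->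
  derivable k1 (0 : R) (1 : R) ->
  derive1 (derive1 (derive1 (fun x => x * f x))) 0 = 3 * k 0.
Proof.
move=> Hf Hk Hk1.
have e1 : derive1 (fun x => x * f x) = fun x => f x + x ^+ 2 * k x.
  apply: derive1_is => x; apply: is_derive_eq (dirM (is_derive_id (x : R) (1 : R)) (Hf x)) _.
  by rewrite /=; ring.
have e2 : derive1 (fun x => f x + x ^+ 2 * k x) =
    fun x => 3 * (x * k x) + x ^+ 2 * k1 x.
  apply: derive1_is => x.
  apply: is_derive_eq (dirD (Hf x)
    (dirM (dirX 1 (is_derive_id (x : R) (1 : R))) (Hk x))) _.
  by rewrite /=; ring.
rewrite e1 e2 derive1E.
have [_ ->] := dirD
  (dirM (dir_cst 0 (1 : R) 3) (dirM (is_derive_id (0 : R) (1 : R)) (Hk 0)))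
  (dirM (dirX 1 (is_derive_id (0 : R) (1 : R))) (derivableP Hk1)).
by rewrite /=; ring.
Qed.

End third_derivative.

(** * From vanishing Douglas curvature to the three equations *)

(** Along an affine curve a directional derivative is an ordinary one. *)
Lemma derive_along (R : realType) (V : normedModType R) (f : V -> R) (v : V)
    (c : R -> V) x : (forall h y, h *: v + c y = c (h + y)) ->
  'D_v f (c x) = derive1 (f \o c) x.
Proof.
move=> cv; rewrite /derive1 /derive.
set F1 := (fun h : R => h^-1 *: _); set F2 := (fun h : R => h^-1 *: _).
suff -> : F1 = F2 by [].
by apply/funext => h; rewrite /F1 /F2 /= cv.
Qed.

Section hypot.
Variables (R : realType) (rho : R).

(** The norm |ybar| along the line ybar = x e_1 + e_2. *)
Definition hypot (x : R) : R := Num.sqrt (1 + x ^+ 2).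

Lemma hypot_neq0 x : hypot x != 0.
Proof. by rewrite gt_eqF// sqrtr_gt0 ltr_wpDr// sqr_ge0. Qed.

Lemma hypot0 : hypot 0 = 1.
Proof. by rewrite /hypot expr0n addr0 sqrtr1. Qed.

Lemma dir_hypot x : is_derive x (1 : R) hypot (x / hypot x).
Proof.
have p1 : 0 < 1 + x ^+ 2 by rewrite ltr_wpDr// sqr_ge0.
have D : is_derive x (1 : R) (fun q : R => 1 + q ^+ 2) (0 + 2 * x ^+ 1 * 1).
  exact: (dirD (dir_cst x (1 : R) 1) (dirX 1 (is_derive_id (x : R) (1 : R)))).
apply: is_derive_eq (dir_sqrt (f := fun q : R => 1 + q ^+ 2) p1 D) _.
rewrite -/(hypot x); have := hypot_neq0 x; move: (hypot x) => s s0.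
by rewrite /=; field.
Qed.

Lemma dir_on_hypot (H : R -> R -> R) (z r x : R) : strip_smooth rho H -> 0 < r < rho ->
  is_derive x (1 : R) (fun x => H (z / hypot x) r)
    (- (x * (z / hypot x * dz H (z / hypot x) r / hypot x ^+ 2))).
Proof.
move=> sH zr.
apply: is_derive_eq (dir_comp (dirM (dir_cst x (1 : R) z)
  (dirV (hypot_neq0 x) (dir_hypot x))) (is_derive_dz _ sH zr)) _.
have := hypot_neq0 x; move: (hypot x) => s s0.
by move: (dz H (z / s) r) => a; field.
Qed.

(** Every derivative along the line is x times a function of the same shape, with
    the exponent raised by 2, since hypot' = x / hypot. *)
Lemma dir_on_hypot_pow (H : R -> R -> R) (b : nat) (z r x : R) :
  strip_smooth rho H -> 0 < r < rho ->
  is_derive x (1 : R) (fun x => H (z / hypot x) r / hypot x ^+ b.+1)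
    (- x * ((b.+1%:R * H (z / hypot x) r + z / hypot x * dz H (z / hypot x) r)
       / hypot x ^+ b.+3)).
Proof.
move=> sH zr; have s0 := hypot_neq0 x.
have sb0 : hypot x ^+ b.+1 != 0 by rewrite expf_neq0.
apply: is_derive_eq (dirM (dir_on_hypot z x sH zr)
  (dirV (f := fun x => hypot x ^+ b.+1) sb0 (dirX b (dir_hypot x)))) _.
move: s0 sb0; rewrite !exprS; move: (hypot x) => s s0.
have : s ^+ b != 0 by rewrite expf_neq0.
move: (H _ _) (dz H (z / s) r) (s ^+ b) (b.+1%:R : R) => a a' u c u0 _.
by field; rewrite s0 u0.
Qed.

(** [third_derivative_mulx] for the functions of [dir_on_hypot_pow], evaluated where
    [hypot] is 1. *)
Lemma euler_third (H : R -> R -> R) (b : nat) (c z r : R) (f : R -> R) :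
  strip_smooth rho H -> 0 < r < rho ->
  (forall x, is_derive x (1 : R) f (x * (c * (H (z / hypot x) r / hypot x ^+ b.+1)))) ->
  derive1 (derive1 (derive1 (fun x => x * f x))) 0 = 3 * (c * H z r).
Proof.
move=> sH zr Hf.
pose G z r := b.+1%:R * H z r + z * dz H z r.
have sG : strip_smooth rho G by rewrite /G; repeat strip_smooth_step.
have Hk x : is_derive x (1 : R) (fun x => c * (H (z / hypot x) r / hypot x ^+ b.+1))
    (c * (- x * (G (z / hypot x) r / hypot x ^+ b.+3))).
  apply: is_derive_eq (dirM (dir_cst x (1 : R) c) (dir_on_hypot_pow b z x sH zr)) _.
  by rewrite mul0r add0r.
have [Dk _] := dirM (dir_cst 0 (1 : R) c)
  (dirM (dirN (is_derive_id (0 : R) (1 : R))) (dir_on_hypot_pow b.+2 z 0 sG zr)).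
apply: eq_trans (third_derivative_mulx Hf Hk Dk) _.
by rewrite hypot0 divr1 expr1n divr1.
Qed.

End hypot.

Section forward.
Variables (R : realType) (m : nat) (rho : R) (F : tangent R m.+2 -> R)
    (phi : R -> R -> R).
Let n := m.+2.
Hypothesis sW : strip_smooth rho (cylW phi).
Hypothesis sT : strip_smooth rho (cylT n phi).
Hypothesis sR : strip_smooth rho (cylR n phi).
Hypothesis proj0E : forall p, regular rho p -> proj_spray F ord0 p = proj0 phi p.
Hypothesis projiE : forall i p, regular rho p ->
  proj_spray F (lift ord0 i) p = proji phi i p.
Hypothesis D0 : vanishing_douglas (cylinder rho) F.

Let i1 : 'I_n := ord0.
Let i2 : 'I_n := lift ord0 ord0.

(** The test points xbar = r e_1, y = (z, x e_1 + e_2). The plane spanned by e_1 and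
    e_2 lets xbar.ybar vanish with a nonzero derivative along e_1. *)
Definition probe (z x r : R) : tangent R n :=
  (r *: delta_mx ord0 (lift ord0 i1),
   z *: delta_mx ord0 ord0 +
     (x *: delta_mx ord0 (lift ord0 i1) + delta_mx ord0 (lift ord0 i2))).

Lemma probe_space1 z x r : space (probe z x r).1 = r *: delta_mx ord0 i1.
Proof. by rewrite /probe -[r *: _]addr0 space_lin space0 addr0 space_delta. Qed.

Lemma probe_space2 z x r : space (probe z x r).2 =
  x *: delta_mx ord0 i1 + delta_mx ord0 i2.
Proof. by rewrite /probe /= !space_lin space_delta0 scaler0 add0r !space_delta. Qed.

Lemma probe_y1 z x r : space (probe z x r).2 ord0 i1 = x.
Proof. by rewrite probe_space2 !mxE !eqxx /= mulr1 addr0. Qed.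

Lemma probe_y2 z x r : space (probe z x r).2 ord0 i2 = 1.
Proof. by rewrite probe_space2 !mxE !eqxx /= mulr0 add0r. Qed.

Lemma probe_x1 z x r : space (probe z x r).1 ord0 i1 = r.
Proof. by rewrite probe_space1 !mxE !eqxx mulr1. Qed.

Lemma probe_x2 z x r : space (probe z x r).1 ord0 i2 = 0.
Proof. by rewrite probe_space1 !mxE !eqxx mulr0. Qed.

Lemma probe_xnorm z x r : 0 <= r -> xnorm (probe z x r) = r.
Proof. by move=> r0; rewrite /xnorm probe_space1 enormZ_delta. Qed.

Lemma probe_xydot z x r : xydot (probe z x r) = r * x.
Proof. by rewrite /xydot probe_space1 dotZl dot_deltal probe_y1. Qed.

Lemma probe_ynorm z x r : ynorm (probe z x r) = hypot x.
Proof.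
rewrite /ynorm enormE probe_space2 /hypot; congr Num.sqrt.
rewrite /dot big_ord_recl big_ord_recl big1 ?addr0; last first.
  by move=> i _; rewrite !mxE /= mulr0 addr0 mulr0.
by rewrite !mxE !eqxx /= mulr1 mulr0 addr0 add0r mulr1 addrC -expr2.
Qed.

Lemma probe_slope z x r : slope (probe z x r) = z / hypot x.
Proof.
rewrite /slope probe_ynorm; congr (_ / _).
by rewrite /probe /= !time_lin time_delta0 !time_delta mulr1 mulr0 !addr0.
Qed.

Lemma probe_regular z x r : 0 < r < rho -> regular rho (probe z x r).
Proof.
move=> zr; have [r0 _] := andP zr; split; first by rewrite probe_xnorm ?ltW.
by rewrite -enorm_gt0 -/(ynorm _) probe_ynorm lt_def hypot_neq0 sqrtr_ge0.
Qed.

Lemma probe_slit z x r : 0 < r < rho -> slit_tangent (cylinder rho) (probe z x r).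
Proof. by move=> /(probe_regular z x)/regular_slit. Qed.

Lemma dy1_probe f z x r :
  dy (lift ord0 i1) f (probe z x r) = derive1 (fun x => f (probe z x r)) x.
Proof.
apply: (@derive_along _ _ f _ (fun x => probe z x r)) => h y.
rewrite /probe; congr pair; rewrite /= ?scaler0 ?add0r//.
by rewrite scalerDl -!addrA [LHS]addrCA.
Qed.

Lemma dy0_probe f z x r :
  dy ord0 f (probe z x r) = derive1 (fun z => f (probe z x r)) z.
Proof.
apply: (@derive_along _ _ f _ (fun z => probe z x r)) => h y.
rewrite /probe; congr pair; rewrite /= ?scaler0 ?add0r//.
by rewrite scalerDl -!addrA.
Qed.

Lemma dy111_probe f z r :
  dy (lift ord0 i1) (dy (lift ord0 i1) (dy (lift ord0 i1) f)) (probe z 0 r) =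
  derive1 (derive1 (derive1 (fun x => f (probe z x r)))) 0.
Proof.
have e g : (fun x => dy (lift ord0 i1) g (probe z x r)) =
    derive1 (fun x => g (probe z x r)).
  by apply/funext => x; exact: dy1_probe.
by rewrite dy1_probe (e (dy (lift ord0 i1) f)) (e f).
Qed.

(** Along the line, Pi^0 is r x s R(z/s) and (s R(z/s))' = x (R - (z/s) R_z) / s. *)
Lemma forward_R z r : 0 < r < rho -> cylR n phi z r - z * dz (cylR n phi) z r = 0.
Proof.
move=> zr; have [r0 _] := andP zr.
have := D0 ord0 (lift ord0 i1) (lift ord0 i1) (lift ord0 i1) (probe_slit z 0 zr).
rewrite /douglas -/(proj_spray F ord0) dy111_probe.
rewrite (_ : (fun x => _) = fun x => x * (r * (hypot x * cylR n phi (z / hypot x) r))).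
  move=> D; pose H z r := cylR n phi z r - z * dz (cylR n phi) z r.
  have sH : strip_smooth rho H by rewrite /H; repeat strip_smooth_step.
  have Df x : is_derive x (1 : R) (fun x => r * (hypot x * cylR n phi (z / hypot x) r))
      (x * (r * (H (z / hypot x) r / hypot x ^+ 1))).
    apply: is_derive_eq (dirM (dir_cst x (1 : R) r)
      (dirM (dir_hypot x) (dir_on_hypot z x sR zr))) _.
    rewrite /H; have := hypot_neq0 x; move: (hypot x) => s s0.
    by move: (cylR _ _ _ _) (dz _ _ _) => a b; field.
  move: D; rewrite (euler_third sH zr Df) => /eqP.
  by rewrite mulf_eq0 pnatr_eq0 mulf_eq0 (gt_eqF r0) => /eqP.
apply/funext => x; rewrite proj0E; last exact: probe_regular.
rewrite /proj0 /pullzr probe_ynorm probe_xydot probe_slope probe_xnorm ?ltW//.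
by ring.
Qed.

(** The term in W of Pi^2 disappears as xbar has no component along e_2, and the
    third derivative of r x T(z/s) at x = 0 is - 3 r z T_z. *)
Lemma forward_T z r : 0 < r < rho -> dz (cylT n phi) z r = 0.
Proof.
move=> zr; have [r0 _] := andP zr.
have sTz := strip_smooth_dz sT.
apply: (mulz_eq0 sTz zr) => {}z.
have := D0 (lift ord0 i2) (lift ord0 i1) (lift ord0 i1) (lift ord0 i1) (probe_slit z 0 zr).
rewrite /douglas -/(proj_spray F _) dy111_probe.
rewrite (_ : (fun x => _) = fun x => x * (r * cylT n phi (z / hypot x) r)).
  move=> D; pose H z r := - (z * dz (cylT n phi) z r).
  have sH : strip_smooth rho H by rewrite /H; repeat strip_smooth_step.
  have Df x : is_derive x (1 : R) (fun x => r * cylT n phi (z / hypot x) r)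
      (x * (r * (H (z / hypot x) r / hypot x ^+ 2))).
    apply: is_derive_eq (dirM (dir_cst x (1 : R) r)
      (dir_on_hypot z x sT zr)) _.
    rewrite /H; have := hypot_neq0 x; move: (hypot x) => s s0.
    by move: (cylT _ _ _ _) (dz _ _ _) => a b; field.
  move: D; rewrite (euler_third sH zr Df) => /eqP.
  by rewrite mulf_eq0 pnatr_eq0 mulf_eq0 (gt_eqF r0) oppr_eq0 => /eqP.
apply/funext => x; rewrite projiE; last exact: probe_regular.
rewrite /proji /pullzr probe_y2 probe_x2 probe_xydot probe_slope probe_xnorm ?ltW//.
by ring.
Qed.

(** As T is constant in z, the y^0 derivative of Pi^1 is - r s W_z(z/s); its
    derivative along e_1 is x (- r) (W_z - (z/s) W_zz) / s. *)
Lemma forward_W z r : 0 < r < rho ->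
  dz (cylW phi) z r - z * dz (dz (cylW phi)) z r = 0.
Proof.
move=> zr; have [r0 _] := andP zr.
have sWz := strip_smooth_dz sW; have sWzz := strip_smooth_dz sWz.
have := D0 (lift ord0 i1) ord0 (lift ord0 i1) (lift ord0 i1) (probe_slit z 0 zr).
rewrite /douglas -/(proj_spray F _).
rewrite dy1_probe.
pose H z r := dz (cylW phi) z r - z * dz (dz (cylW phi)) z r.
have e0 x : dy ord0 (proj_spray F (lift ord0 i1)) (probe z x r) =
    - r * (hypot x * dz (cylW phi) (z / hypot x) r).
  rewrite dy0_probe.
  rewrite (_ : (fun z => _) = fun z => r * x * x * cylT n phi (z / hypot x) r +
      (- r * hypot x ^+ 2) * cylW phi (z / hypot x) r).
    rewrite derive1E.
    have dq : is_derive z (1 : R) (fun z => z / hypot x) (hypot x)^-1.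
      apply: is_derive_eq (dirM (is_derive_id (z : R) (1 : R)) (dir_cst z (1 : R) _)) _.
      by rewrite mul1r mulr0 addr0.
    have [_ ->] := dirD
      (dirM (dir_cst z (1 : R) (r * x * x)) (dir_comp dq (is_derive_dz _ sT zr)))
      (dirM (dir_cst z (1 : R) (- r * hypot x ^+ 2))
         (dir_comp dq (is_derive_dz _ sW zr))).
    rewrite forward_T//; have := hypot_neq0 x; move: (hypot x) => s s0.
    by move: (dz _ _ _) => a; field.
  apply/funext => y; rewrite projiE; last exact: probe_regular.
  rewrite /proji /pullzr probe_y1 probe_x1 probe_xydot probe_slope probe_xnorm ?ltW//.
  by rewrite probe_ynorm; ring.
have e1 x : dy (lift ord0 i1) (dy ord0 (proj_spray F (lift ord0 i1))) (probe z x r) =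
    x * (- r * (H (z / hypot x) r / hypot x ^+ 1)).
  rewrite dy1_probe; under eq_fun do rewrite e0.
  rewrite derive1E.
  have [_ ->] := dirM (dir_cst x (1 : R) (- r))
      (dirM (dir_hypot x) (dir_on_hypot z x sWz zr)).
  rewrite /H; have := hypot_neq0 x; move: (hypot x) => s s0.
  by move: (dz (dz _) _ _) (dz _ _ _) => a b; field.
under eq_fun do rewrite e1.
have sH : strip_smooth rho H by rewrite /H; repeat strip_smooth_step.
rewrite derive1E.
have [_ ->] := dirM (is_derive_id (0 : R) (1 : R))
  (dirM (dir_cst 0 (1 : R) (- r)) (dir_on_hypot_pow 0 z 0 sH zr)).
rewrite hypot0 !divr1 /= !(mul1r, mul0r, addr0, add0r) => /eqP.
by rewrite mulf_eq0 oppr_eq0 (gt_eqF r0) => /eqP.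
Qed.

End forward.

(** * From the three equations to vanishing Douglas curvature *)

Section fibre_polynomials.
Variables (R : realType) (n : nat).
Implicit Types (f g a : tangent R n -> R) (w : 'rV[R]_n.+1).

(** Polynomials of degree at most [k] in y with coefficients depending on x,
    characterized by their derivatives, so that vanishing third derivatives are
    immediate in degree 2. *)
Fixpoint ypoly (k : nat) f : Prop :=
  if k is k'.+1 then
    forall w, exists2 g, (forall p, is_derive p ((0, w) : tangent R n) f (g p)) & ypoly k' g
  else forall x y y', f (x, y) = f (x, y').

Lemma ypoly0_derive a w p : ypoly 0 a -> is_derive p ((0, w) : tangent R n) a 0.
Proof.
move=> ya; have := @dir_cst R (tangent R n) p (0, w) (a p).
apply: is_derive_eq_line; case: p => x y h.
by rewrite -[h *: _ + _]/(h *: 0 + x, h *: w + y) scaler0 add0r; exact: ya.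
Qed.

Lemma ypolyD k f g : ypoly k f -> ypoly k g -> ypoly k (fun p => f p + g p).
Proof.
elim: k f g => [|k IH] f g /= yf yg; first by move=> x y y'; rewrite (yf x y y') (yg x y y').
move=> w; have [f' Df yf'] := yf w; have [g' Dg yg'] := yg w.
by exists (fun p => f' p + g' p); [move=> p; exact: dirD|exact: IH].
Qed.

Lemma ypolyZ k a f : ypoly 0 a -> ypoly k f -> ypoly k (fun p => a p * f p).
Proof.
move=> ya; elim: k f => [|k IH] f /= yf; first by move=> x y y'; rewrite (yf x y y') (ya x y y').
move=> w; have [f' Df yf'] := yf w; exists (fun p => a p * f' p); last exact: IH.
move=> p; apply: is_derive_eq (dirM (ypoly0_derive w p ya) (Df p)) _.
by rewrite mul0r add0r.
Qed.

Lemma ypolyM11 f g : ypoly 1 f -> ypoly 1 g -> ypoly 2 (fun p => f p * g p).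
Proof.
move=> yf yg w; have [f' Df yf'] := yf w; have [g' Dg yg'] := yg w.
exists (fun p => f' p * g p + g' p * f p).
  by move=> p; apply: is_derive_eq (dirM (Df p) (Dg p)) _; rewrite [X in _ + X]mulrC.
exact: (ypolyD (k := 1) (ypolyZ yf' yg) (ypolyZ yg' yf)).
Qed.

Lemma ypoly_sum k (f : 'I_n -> tangent R n -> R) :
  (forall i, ypoly k (f i)) -> ypoly k (fun p => \sum_i f i p).
Proof.
elim: k f => [|k IH] f yf /=; first by move=> x y y'; apply: eq_bigr => i _; exact: yf.
move=> w; have /choice [f' f'P] : forall i, exists g,
    (forall p, is_derive p ((0, w) : tangent R n) (f i) (g p)) /\ ypoly k g.
  by move=> i; have [g ? ?] := yf i w; exists g.
exists (fun p => \sum_i f' i p); last by apply: IH => i; have [] := f'P i.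
by move=> p; apply: dir_sum => i; have [] := f'P i.
Qed.

Lemma ypoly_ycoord A : ypoly 1 (fun p : tangent R n => p.2 ord0 A).
Proof. by move=> w; exists (fun=> w ord0 A) => // p; exact: dir_ycoord. Qed.

Lemma ypoly_y i : ypoly 1 (fun p : tangent R n => space p.2 ord0 i).
Proof. by move=> w; exists (fun=> space w ord0 i) => // p; exact: dir_y. Qed.

Lemma ypoly_time : ypoly 1 (fun p : tangent R n => time p.2).
Proof. exact: ypoly_ycoord. Qed.

Lemma ypoly_xydot : ypoly 1 (@xydot R n).
Proof. by apply: ypoly_sum => i; apply: ypolyZ => //; exact: ypoly_y. Qed.

Lemma ypoly_ynorm2 : ypoly 2 (fun p : tangent R n => ynorm p ^+ 2).
Proof.
have -> : (fun p : tangent R n => ynorm p ^+ 2) =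
    fun p => \sum_i space p.2 ord0 i * space p.2 ord0 i.
  by apply/funext => p; rewrite ynorm_sum.
by apply: ypoly_sum => i; apply: ypolyM11; exact: ypoly_y.
Qed.

Lemma ypoly2_third f B C D : ypoly 2 f -> dy D (dy C (dy B f)) = fun=> 0.
Proof.
move=> yf; have [f1 D1 y1] := yf (delta_mx ord0 B).
have [f2 D2 y2] := y1 (delta_mx ord0 C).
have -> : dy B f = f1 by apply/funext => p; have [_] := D1 p.
have -> : dy C f1 = f2 by apply/funext => p; have [_] := D2 p.
by apply/funext => p; have [_] := ypoly0_derive (delta_mx ord0 D) p y2.
Qed.

End fibre_polynomials.

Section backward.
Variables (R : realType) (n : nat) (rho : R) (F : tangent R n -> R)
    (phi : R -> R -> R).
Hypothesis rho0 : 0 < rho.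
Hypothesis sW : strip_smooth rho (cylW phi).
Hypothesis sT : strip_smooth rho (cylT n phi).
Hypothesis sR : strip_smooth rho (cylR n phi).
Hypothesis proj0E : forall p, regular rho p -> proj_spray F ord0 p = proj0 phi p.
Hypothesis projiE : forall i p, regular rho p ->
  proj_spray F (lift ord0 i) p = proji phi i p.
Hypothesis cond : forall z r : R, 0 < r -> r < rho ->
     [/\ cylR n phi z r - z * dz (cylR n phi) z r = 0,
         dz (cylT n phi) z r = 0 &
         dz (cylW phi) z r - z * dz (dz (cylW phi)) z r = 0].

(** The projective part after integration of the three equations, with s z = y^0. *)
Definition quad0 (p : tangent R n) : R :=
  dz (cylR n phi) 0 (xnorm p) * (xydot p * time p.2).

Definition quadi (i : 'I_n) (p : tangent R n) : R :=
  cylT n phi 0 (xnorm p) * (xydot p * space p.2 ord0 i) +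
  (- space p.1 ord0 i * cylW phi 0 (xnorm p) * ynorm p ^+ 2 +
   - space p.1 ord0 i * (dz (dz (cylW phi)) 0 (xnorm p) / 2) * (time p.2 * time p.2)).

Lemma ypoly_quad0 : ypoly 2 quad0.
Proof.
apply: ypolyZ => //; apply: ypolyM11; [exact: ypoly_xydot|exact: ypoly_time].
Qed.

Lemma ypoly_quadi i : ypoly 2 (quadi i).
Proof.
apply: ypolyD.
  by apply: ypolyZ => //; apply: ypolyM11; [exact: ypoly_xydot|exact: ypoly_y].
apply: ypolyD; first by apply: ypolyZ => //; exact: ypoly_ynorm2.
by apply: ypolyZ => //; apply: ypolyM11; exact: ypoly_time.
Qed.

Lemma proj0_quad p : regular rho p -> proj_spray F ord0 p = quad0 p.
Proof.
move=> Op; have [p1 p2 x0 y0] := regularP Op; have [pr _] := Op.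
have /andP[r0 rr] := pr.
have H z : cylR n phi z (xnorm p) - z * dz (cylR n phi) z (xnorm p) = 0.
  by have [] := cond z r0 rr.
rewrite proj0E// /proj0 /quad0 /pullzr (euler_linear sR pr H (slope p)).
have -> : time p.2 = slope p * ynorm p by rewrite /slope divfK.
by ring.
Qed.

Lemma proji_quad i p : regular rho p -> proj_spray F (lift ord0 i) p = quadi i p.
Proof.
move=> Op; have [p1 p2 x0 y0] := regularP Op; have [pr _] := Op.
have /andP[r0 rr] := pr.
have HT z : dz (cylT n phi) z (xnorm p) = 0 by have [] := cond z r0 rr.
have HW z : dz (cylW phi) z (xnorm p) - z * dz (dz (cylW phi)) z (xnorm p) = 0.
  by have [] := cond z r0 rr.
rewrite projiE// /proji /quadi /pullzr (dz_eq0_cst sT pr HT (slope p)) (euler_quadratic sW pr HW (slope p)).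
have -> : time p.2 = slope p * ynorm p by rewrite /slope divfK.
by ring.
Qed.

Lemma douglas_regular A B C D p : regular rho p -> douglas F A B C D p = 0.
Proof.
move=> Op; have oU := @open_regular R n rho rho0.
have [Q [yQ EQ]] : exists Q, ypoly 2 Q /\ forall p, regular rho p -> proj_spray F A p = Q p.
  case: (unliftP ord0 A) => [i|] ->.
    by exists (quadi i); split; [exact: ypoly_quadi|exact: proji_quad].
  by exists quad0; split; [exact: ypoly_quad0|exact: proj0_quad].
rewrite /douglas -/(proj_spray F A).
rewrite (dy_eq D oU (dy_eq C oU (dy_eq B oU EQ)) Op).
by rewrite ypoly2_third.
Qed.

End backward.

Section extension.
Variables (R : realType) (m : nat) (rho : R).
Hypothesis rho0 : 0 < rho.
Let n := m.+1.

(** Moving xbar or ybar along the first axis when it vanishes makes any point of the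
    slit tangent bundle a limit of regular points. *)
Lemma regular_dense (f : tangent R n -> R) p :
  slit_tangent (cylinder rho) p -> {for p, continuous f} ->
  (forall q, regular rho q -> f q = 0) -> f p = 0.
Proof.
move=> Mp cf f0.
pose d (a : 'rV[R]_n.+1) : 'rV[R]_n.+1 :=
  if space a == 0 then delta_mx ord0 (lift ord0 ord0) else 0.
pose c (h : R) : tangent R n := h *: ((d p.1, d p.2) : tangent R n) + p.
have dP (a : 'rV[R]_n.+1) (h : R) : h != 0 -> space (h *: d a + a) != 0.
  move=> h0; rewrite space_lin /d; have [a0|a0] := eqVneq (space a) 0.
    rewrite a0 addr0 space_delta scaler_eq0 (negPf h0) /=.
    apply/eqP => /rowP /(_ ord0); rewrite !mxE !eqxx => /eqP.
    by rewrite oner_eq0.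
  by rewrite space0 scaler0 add0r.
have c0 : c 0 = p by rewrite /c scale0r add0r.
have cc : {for 0, continuous c}.
  by apply: differentiable_continuous; apply: differentiableD.
have cfc : (f \o c) h @[h --> (0 : R)] --> f p.
  have cf0 : {for c 0, continuous f} by rewrite c0.
  by rewrite -[f p]/(f p) -(congr1 f c0); exact: continuous_comp cc cf0.
have nearM : \forall h \near (0 : R), slit_tangent (cylinder rho) (c h).
  apply: cc; rewrite c0; apply: open_nbhs_nbhs; split=> //.
  exact: open_slit.
have cfc' : (f \o c) h @[h --> (0 : R)^'] --> f p by exact: cvg_within_filter.
have cf0 : (f \o c) h @[h --> (0 : R)^'] --> (0 : R).
  apply: cvg_near_cst; near=> h.
  have h0 : h != 0 by near: h; exact: nbhs_dnbhs_neq.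
  have [Mh _] : slit_tangent (cylinder rho) (c h) by near: h; exact: nbhs_dnbhs.
  apply: f0; split; last exact: dP.
  by rewrite /xnorm enorm_gt0 dP//= Mh.
exact: cvg_unique cfc' cf0.
Unshelve. all: by end_near. Qed.

End extension.

(** The spray is rational in the derivatives of F^2, with denominator the determinant
    of the fundamental tensor. *)
Lemma smooth_douglas (R : realType) (n : nat) (U : set (tangent R n))
    (F : tangent R n -> R) A B C D :
  open U -> smooth_on U (sqF F) ->
  (forall p, U p -> fundamental F p \in unitmx) ->
  smooth_on U (douglas F A B C D).
Proof.
move=> oU sL ug.
have sS E : smooth_on U (spray F E).
  apply: smoothM => //; first exact: smooth_cst.
  apply: smooth_sum => // i; apply: smoothM => //.
    apply: smooth_invmx => // k l.
    apply: (@smooth_eq _ _ _ (fun p => 2^-1 * dy l (dy k (sqF F)) p)) => //.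
      by move=> p _; rewrite mxE.
    apply: smoothM => //; first exact: smooth_cst.
    by do 2!apply: smooth_derive.
  apply: smoothB => //; last exact: smooth_derive.
  apply: smooth_sum => // j; apply: smoothM => //; last exact: smooth_ycoord.
  by do 2!apply: smooth_derive.
do 3!apply: smooth_derive.
apply: smoothB => //; apply: smoothM => //; last exact: smooth_ycoord.
apply: smoothM => //; first exact: smooth_cst.
by apply: smooth_sum => // E; exact: smooth_derive.
Qed.

Theorem lemma2 (R : realType) (n : nat) (rho : R) (F : tangent R n -> R)
    (phi : R -> R -> R)
    (hn : (2 <= n)%N) (hrho : 0 < rho)
    (hphi : forall z r : R, 0 < r -> r < rho ->
       differentiable (fun q : R * R => phi q.1 q.2) ((z, r) : R * R))
    (hF : is_finsler (cylinder rho) F)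
    (hform : has_cyl_form rho F phi) :
  vanishing_douglas (cylinder rho) F <->
  (forall z r : R, 0 < r -> r < rho ->
     [/\ cylR n phi z r - z * dz (cylR n phi) z r = 0,
         dz (cylT n phi) z r = 0 &
         dz (cylW phi) z r - z * dz (dz (cylW phi)) z r = 0]).
Proof.
case: n hn F hF hform => [|[|m]] // _ F hF hform.
have sphi : strip_smooth rho phi := smooth_phi hrho hF hform.
have phi0 (z r : R) : 0 < r < rho -> 0 < phi z r by exact: phi_gt0 hF hform z r.
have FE p : regular rho p -> sqF F p = ynorm p ^+ 2 * pullzr phi p.
  by move=> /(phi_gt0_sqF hF hform)[].
have gpos p : regular rho p -> forall w : 'rV[R]_m.+3, w != 0 ->
    0 < \sum_A \sum_B fundamental F p A B * w ord0 A * w ord0 B.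
  by move=> /regular_slit; have [_ _ _ _] := hF; apply.
have N0 (z r : R) : 0 < r < rho -> 0 < 2 * phi z r - z * dz phi z r.
  move=> zr; have Op := slice_regular m.+1 z zr; have [r0 _] := andP zr.
  have [v v0 yv] := exists_orthogonal (space (slice_pt m.+1 z r).2).
  have := cyl_N_gt0 hrho sphi FE gpos Op v0 yv.
  by rewrite /pullzr; have [-> _ ->] := slice_coords m.+1 z (ltW r0).
have hess0 (z r : R) : 0 < r < rho -> 0 < 2 * phi z r * dz (dz phi) z r - dz phi z r ^+ 2.
  move=> zr; have Op := slice_regular m.+1 z zr; have [r0 _] := andP zr.
  have := cyl_hess_gt0 hrho sphi FE gpos Op.
  rewrite /pullzr; have [-> _ ->] := slice_coords m.+1 z (ltW r0).
  by apply; exact: phi0.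
have sW := strip_smooth_W sphi N0.
have sT := strip_smooth_T sphi N0 hess0 m.+2.
have sR := strip_smooth_R sphi N0 hess0 m.+2.
have P0 := proj_spray0 hrho sphi FE gpos phi0 N0 hess0.
have Pi := proj_sprayi hrho sphi FE gpos phi0 N0 hess0.
split=> [D0 z r r0 rr|cond A B C D p Mp].
  have zr : 0 < r < rho by rewrite r0.
  split; first exact: forward_R sR P0 D0 z r zr.
    exact: forward_T sT Pi D0 z r zr.
  exact: forward_W sW sT Pi D0 z r zr.
apply: (regular_dense hrho Mp) => [|q Oq]; last first.
  exact: douglas_regular hrho sW sT sR P0 Pi cond A B C D q Oq.
apply: differentiable_continuous.
apply: smooth_differentiable Mp; apply: smooth_douglas.
- exact: open_slit.
- exact: smooth_sqF hrho hF.
- by move=> q Mq; apply: posdef_unitmx; have [_ _ _ _] := hF; apply.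
Qed.
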